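(* Let $G$ be a finite graph embedded in a bounded domain $\Omega\subset\mathbb{R}^N$ with $C^\infty$ boundary, in the sense that $VG\subset\Omega$, with all Voronoi cells $N(v)$ path-connected, let $K(x,y;t)$ be the (Dirichlet) heat kernel on $\Omega$, let $\{\eta_v\}_{v\in VG}$ be a family of cut-off functions as described in the context, and for $v_1,v_2\in VG$, $t>0$ set $$H_0(v_1,v_2;t)=\frac{1}{\sqrt{\mu_{v_1}\mu_{v_2}}}\int_{N(v_1)}\int_{N(v_2)}K(x,y;t)\,\eta_{v_1}(x)\,\eta_{v_2}(y)\,dy\,dx.$$ Then: (i) For all $v_1,v_2\in VG$, $\lim_{t\to0}H_0(v_1,v_2;t)$ equals $1$ if $v_1=v_2$ and $0$ if $v_1\neq v_2$. (ii) For any integer $k\geq0$ and all $v_1,v_2\in VG$, there is a constant $C_k(v_1,v_2)$ such that for all $t>0$ $$\left|\frac{\partial^k}{\partial t^k}H_0(v_1,v_2;t)\right|\leq C_k(v_1,v_2).$$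
   Context: $\Omega\subset\mathbb{R}^N$ is a bounded domain with $C^\infty$ boundary, $\Delta_\Omega f=-\sum_{i=1}^N\partial^2f/\partial x_i^2$, and $K(x,y;t)$ is the heat kernel on $\Omega$ with Dirichlet boundary condition, i.e. the fundamental solution of $(\Delta_\Omega+\partial_t)K(x,y;t)=0$ on $\Omega\times\Omega\times(0,\infty)$ with $\lim_{t\to0}K(x,y;t)=\delta_x$ (Dirac mass at $x$). $G$ is a finite graph with vertex set $VG\subset\Omega$. $d$ is Euclidean distance and $m$ is Lebesgue measure (also written $dx$). For $v\in VG$ the Voronoi cell is $N(v)=\{x\in\Omega: d(x,v)<d(x,v')\text{ for all }v'\in VG,\ v'\ne v\}$, assumed path-connected for every $v$; $\mu_v=m(N(v))$. For $\delta>0$ let $N_\delta(v)=\{x\in N(v): d(x,\partial N(v))<\delta\}$. Fix $\epsilon>0$ and choose $\delta>0$ (depending on $\epsilon$ and $G$) such that $N(v)\setminus N_\delta(v)\neq\emptyset$ and $m(N_\delta(v))<\epsilon/|VG|$ for all $v\in VG$. The functions $\eta_v:\Omega\to[0,\infty)$, $v\in VG$, are $C^\infty$ functions satisfying: (a) $\eta_v(x)=0$ whenever $x\notin N(v)$; (b) $\eta_v\equiv1$ on $N(v)\setminus N_\delta(v)$ and $\eta_v\equiv0$ on $N_{\delta/2}(v)$; (c) $\int_\Omega\eta_v(x)^2\,dx=\mu_v$. *)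

(* Defs.v *)
From HB Require Import structures.
From mathcomp Require Import all_boot all_order all_algebra finmap.
From mathcomp Require Import all_classical all_reals all_analysis.

Set Implicit Arguments.
Unset Strict Implicit.
Unset Printing Implicit Defensive.

Import Order.TTheory GRing.Theory Num.Theory.
Import numFieldNormedType.Exports.

Local Open Scope classical_set_scope.
Local Open Scope ring_scope.

(* ['rV[R]_n] carries the Borel sigma-algebra, presented as the one generated
   by the coordinate maps (the topology of ['rV[R]_n] is the product one). *)
Definition rV_display : measure_display.
Proof. exact: default_measure_display. Qed.

Section measurable_rV.
Context {R : realType} {n : nat}.

Let coord (i : 'I_n) (x : 'rV[R]_n) : measurableTypeR R := x ord0 i.

Let rV_set0 : g_sigma_preimage coord set0.
Proof. exact: sigma_algebra0. Qed.

Let rV_setC A : g_sigma_preimage coord A -> g_sigma_preimage coord (~` A).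
Proof. exact: sigma_algebraC. Qed.

Let rV_bigcup (F : _^nat) : (forall i, g_sigma_preimage coord (F i)) ->
  g_sigma_preimage coord (\bigcup_i (F i)).
Proof. exact: sigma_algebra_bigcup. Qed.

HB.instance Definition _ := @isMeasurable.Build rV_display
  'rV[R]_n (g_sigma_preimage coord) rV_set0 rV_setC rV_bigcup.

Lemma measurable_coord_rV (i : 'I_n) :
  measurable_fun setT (fun x : 'rV[R]_n => x ord0 i : measurableTypeR R).
Proof.
move=> _ Y mY; rewrite setTI; apply: sub_sigma_algebra => /=.
rewrite -bigcup_seq/=; exists i => /=; first by rewrite mem_index_enum.
by exists Y => //; rewrite setTI.
Qed.

Lemma measurable_fun_rV d (T : measurableType d) (f : T -> 'rV[R]_n) :
  (forall i, measurable_fun setT (fun x => f x ord0 i : measurableTypeR R)) ->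
  measurable_fun setT f.
Proof.
move=> mf; pose G := \big[setU/set0]_(i < n)
  preimage_set_system setT (coord i) measurable.
apply: (@measurability _ _ _ _ _ _ G) => //.
move=> _ [B + <-]; rewrite /G -bigcup_seq/= => -[i _ [Y mY <-]].
rewrite !setTI -[X in measurable X]setTI.
exact: (mf i measurableT Y mY).
Qed.

End measurable_rV.

Section lebesgue_step.
Context {R : realType} {n : nat}.

Definition rV_cons (p : measurableTypeR R * 'rV[R]_n) : 'rV[R]_n.+1 :=
  row_mx (const_mx p.1 : 'rV[R]_1) p.2.

Lemma measurable_rV_cons : measurable_fun setT rV_cons.
Proof.
apply: measurable_fun_rV => i; case: (@split_ordP 1 n i) => j ->.
  rewrite [X in measurable_fun _ X](_ : _ = fst) //.
  apply/funext => p; apply: etrans (_ : (const_mx p.1 : 'rV_1) ord0 j = _).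
    exact: row_mxEl.
  by rewrite mxE.
rewrite [X in measurable_fun _ X](_ : _ =
    (fun v : 'rV[R]_n => v ord0 j : measurableTypeR R) \o snd); last first.
  by apply/funext => p; exact: row_mxEr.
by apply: measurableT_comp => //; exact: measurable_coord_rV.
Qed.

Definition rV_uncons (x : 'rV[R]_n.+1) : measurableTypeR R * 'rV[R]_n :=
  (x ord0 ord0, \row_j x ord0 (lift ord0 j)).

Lemma measurable_rV_uncons : measurable_fun setT rV_uncons.
Proof.
apply: measurable_fun_pair; first exact: measurable_coord_rV.
apply: measurable_fun_rV => i.
rewrite [X in measurable_fun _ X](_ : _ =
    fun x : 'rV[R]_n.+1 => x ord0 (lift ord0 i) : measurableTypeR R).
  exact: measurable_coord_rV.
by apply/funext => x /=; rewrite mxE.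
Qed.

Lemma rV_consK : cancel rV_cons rV_uncons.
Proof.
case=> a v; congr pair => /=.
  have -> : (ord0 : 'I_n.+1) = @lshift 1 n ord0 by exact/val_inj.
  apply: etrans (_ : (const_mx a : 'rV_1) ord0 ord0 = _); last by rewrite mxE.
  exact: row_mxEl.
apply/rowP => j; rewrite mxE.
have -> : lift ord0 j = @rshift 1 n j by exact/val_inj.
exact: row_mxEr.
Qed.

Variable mu : {sigma_finite_measure set 'rV[R]_n -> \bar R}.

Definition lebesgue_step : set 'rV[R]_n.+1 -> \bar R :=
  pushforward (lebesgue_measure \x mu)%E rV_cons.

Let preimage_rV_cons A : measurable A -> measurable (rV_cons @^-1` A).
Proof.
by move=> mA; rewrite -[X in measurable X]setTI; exact: measurable_rV_cons.
Qed.

Let lebesgue_step0 : lebesgue_step set0 = 0%E.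
Proof. by rewrite /lebesgue_step /pushforward preimage_set0 measure0. Qed.

Let lebesgue_step_ge0 A : (0 <= lebesgue_step A)%E.
Proof. by rewrite /lebesgue_step /pushforward measure_ge0. Qed.

Let lebesgue_step_sigma_additive : semi_sigma_additive lebesgue_step.
Proof.
move=> F mF tF mUF; rewrite /lebesgue_step /pushforward preimage_bigcup.
apply: measure_semi_sigma_additive.
- by move=> k; exact: preimage_rV_cons.
- apply/trivIsetP => /= i j _ _ ij; rewrite -preimage_setI.
  by move/trivIsetP : tF => /(_ _ _ _ _ ij) ->//; rewrite preimage_set0.
- by rewrite -preimage_bigcup; exact: preimage_rV_cons.
Qed.

HB.instance Definition _ := isMeasure.Build _ _ _ lebesgue_step
  lebesgue_step0 lebesgue_step_ge0 lebesgue_step_sigma_additive.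

Let lebesgue_step_sigma_finite : sigma_finite setT lebesgue_step.
Proof.
have /sigma_finiteP[F [TF ndF Foo]] := sigma_finiteT (@lebesgue_measure R).
have /sigma_finiteP[G [TG ndG Goo]] := sigma_finiteT mu.
exists (fun k => rV_uncons @^-1` (F k `*` G k)).
  apply/esym; rewrite -subTset => x _.
  have [i _ Fi] : (\bigcup_i F i) (rV_uncons x).1 by rewrite -TF.
  have [j _ Gj] : (\bigcup_i G i) (rV_uncons x).2 by rewrite -TG.
  exists (maxn i j) => //; split.
  - by move: Fi; exact/subsetPset/ndF/leq_maxl.
  - by move: Gj; exact/subsetPset/ndG/leq_maxr.
move=> k; have [mF Fk] := Foo k; have [mG Gk] := Goo k; split.
  rewrite -[X in measurable X]setTI; apply: measurable_rV_uncons => //.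
  exact: measurableX.
rewrite /lebesgue_step /pushforward -comp_preimage.
rewrite (_ : rV_uncons \o rV_cons = id); last exact/funext/rV_consK.
by rewrite preimage_id product_measure1E// lte_mul_pinfty// ge0_fin_numE.
Qed.

HB.instance Definition _ := @Measure_isSigmaFinite.Build _ _ _
  lebesgue_step lebesgue_step_sigma_finite.

End lebesgue_step.

Fixpoint lebesgue_rV (R : realType) (n : nat) :
    {sigma_finite_measure set 'rV[R]_n -> \bar R} :=
  match n with
  | 0 => \d_(0 : 'rV[R]_0)
  | n'.+1 => lebesgue_step (lebesgue_rV R n')
  end.

Lemma lebesgue_rV_box (R : realType) (n : nat)
    (A : 'I_n -> set (measurableTypeR R)) :
  (forall i, measurable (A i)) ->
  lebesgue_rV R n [set x | forall i, A i (x ord0 i)] =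
    (\prod_(i < n) lebesgue_measure (A i))%E.
Proof.
elim: n A => [|n IHn] A mA.
  by rewrite big_ord0 /= diracE mem_set// => -[].
rewrite big_ord_recl -IHn//.
have mB : measurable [set x : 'rV[R]_n | forall i, A (lift ord0 i) (x ord0 i)].
  rewrite [X in measurable X](_ : _ = \big[setI/setT]_(i < n)
      ((fun x : 'rV[R]_n => x ord0 i : measurableTypeR R) @^-1`
        A (lift ord0 i))).
    apply: bigsetI_measurable => i _.
    by rewrite -[X in measurable X]setTI; exact: measurable_coord_rV.
  apply/seteqP; split=> x.
    by move=> Ax; rewrite -bigcap_seq => i _; exact: Ax.
  by rewrite -bigcap_seq => Ax i; apply: Ax; rewrite /= mem_index_enum.
rewrite -product_measure1E//.
rewrite /= /lebesgue_step /pushforward; congr (_ _).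
apply/seteqP; split=> -[a v] /=.
  move=> Aav; have := rV_consK (a, v) => -[ha hv]; split.
    by rewrite -ha; exact: Aav.
  by move=> i; have := Aav (lift ord0 i); rewrite -[in X in _ -> X]hv mxE.
move=> -[Aa Av] i; have := rV_consK (a, v) => -[ha hv].
case: (unliftP ord0 i) => [j ->|->]; last by rewrite ha.
by have := Av j; rewrite -[in X in X -> _]hv mxE.
Qed.

(* The norm of the library on ['rV[R]_n] is the sup norm: it induces the usual
   topology but not the Euclidean distance. *)
Definition eucl_dist (R : realType) (n : nat) (x y : 'rV[R]_n) : R :=
  Num.sqrt (\sum_(i < n) (x ord0 i - y ord0 i) ^+ 2).

Definition set_dist (R : realType) (n : nat) (x : 'rV[R]_n)
    (A : set 'rV[R]_n) : R :=
  inf [set eucl_dist x y | y in A].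

Definition boundary (T : topologicalType) (A : set T) : set T :=
  closure A `\` interior A.

Definition path_connected (R : realType) (T : topologicalType) (A : set T) :=
  forall x y, A x -> A y -> exists g : R -> T,
    [/\ {within `[0, 1], continuous g}, g 0 = x, g 1 = y &
        forall t, 0 <= t <= 1 -> A (g t)].

Definition pderiv (R : realType) (n : nat) (i : 'I_n) (f : 'rV[R]_n -> R) :
  'rV[R]_n -> R := fun x => 'D_(delta_mx ord0 i) f x.

Definition pderivs (R : realType) (n : nat) (s : seq 'I_n)
  (f : 'rV[R]_n -> R) : 'rV[R]_n -> R := foldr (@pderiv R n) f s.

Definition smooth_on (R : realType) (n : nat) (U : set 'rV[R]_n)
    (f : 'rV[R]_n -> R) :=
  forall (s : seq 'I_n) x, U x ->
    {for x, continuous (pderivs s f)} /\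
    forall i, derivable (pderivs s f) x (delta_mx ord0 i).

(* Near each boundary point the set is, after relabelling and reorienting the
   coordinate axes, the region above the graph of a smooth function of the
   other coordinates. *)
Definition smooth_boundary (R : realType) (n : nat) (Omega : set 'rV[R]_n.+1) :=
  forall z, boundary Omega z ->
    exists (r : R) (i : 'I_n.+1) (b : bool) (gamma : 'rV[R]_n -> R),
      [/\ 0 < r, smooth_on setT gamma &
          forall x, eucl_dist x z < r ->
            (Omega x <-> 0 < (-1) ^+ b * (x ord0 i - gamma (col' i x)))].

Definition bounded_smooth_domain (R : realType) (n : nat)
    (Omega : set 'rV[R]_n.+1) :=
  [/\ open Omega, connected Omega, Omega !=set0, bounded_set Omega &
      smooth_boundary Omega].

Definition laplacian (R : realType) (n : nat) (f : 'rV[R]_n -> R) :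
  'rV[R]_n -> R := fun x => - \sum_(i < n) pderiv i (pderiv i f) x.

Definition class_C21 (R : realType) (n : nat) (Omega : set 'rV[R]_n)
    (u : 'rV[R]_n -> R -> R) :=
  forall (y : 'rV[R]_n) (t : R), Omega y -> 0 < t ->
    [/\ [/\ forall i, derivable (u ^~ t) y (delta_mx ord0 i),
            forall i j, derivable (pderiv i (u ^~ t)) y (delta_mx ord0 j) &
            derivable (u y) t 1],
        {for (y, t), continuous (fun p : 'rV[R]_n * R => u p.1 p.2)},
        forall i, {for (y, t), continuous
          (fun p : 'rV[R]_n * R => pderiv i (u ^~ p.2) p.1)},
        forall i j, {for (y, t), continuous
          (fun p : 'rV[R]_n * R => pderiv j (pderiv i (u ^~ p.2)) p.1)} &
        {for (y, t), continuous
          (fun p : 'rV[R]_n * R => derive1 (u p.1) p.2)}].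

(* [K x] is the fundamental solution with pole [x]: the Laplacian acts on
   [y]. The initial condition says that, as t -> 0, the measures
   [K x y t dy] on Omega converge weakly (i.e. against bounded continuous
   functions) to the Dirac mass at [x]; nonnegativity makes them measures. The
   Dirichlet condition is that [K x] extends continuously by 0 to
   boundary Omega x (0, oo). *)
Record dirichlet_heat_kernel (R : realType) (n : nat) (Omega : set 'rV[R]_n)
    (K : 'rV[R]_n -> 'rV[R]_n -> R -> R) : Prop := DirichletHeatKernel {
  heat_kernel_continuous : forall (x y : 'rV[R]_n) (t : R),
    Omega x -> Omega y -> 0 < t ->
    {for (x, y, t), continuous
      (fun p : 'rV[R]_n * 'rV[R]_n * R => K p.1.1 p.1.2 p.2)} ;
  heat_kernel_ge0 : forall (x y : 'rV[R]_n) (t : R),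
    Omega x -> Omega y -> 0 < t -> 0 <= K x y t ;
  heat_kernel_C21 : forall x, Omega x -> class_C21 Omega (K x) ;
  heat_kernel_eq : forall (x y : 'rV[R]_n) (t : R),
    Omega x -> Omega y -> 0 < t ->
    laplacian (K x ^~ t) y + derive1 (K x y) t = 0 ;
  heat_kernel_boundary : forall (x z : 'rV[R]_n) (t : R),
    Omega x -> boundary Omega z -> 0 < t ->
    (fun p : 'rV[R]_n * R => K x p.1 p.2)
      @ within (Omega `*` setT) (nbhs (z, t)) --> 0 ;
  heat_kernel_dirac : forall (f : 'rV[R]_n -> R) x, Omega x ->
    (forall y, Omega y -> {for y, continuous f}) ->
    (exists M, forall y, Omega y -> `|f y| <= M) ->
    (\int[lebesgue_rV R n]_(y in Omega) (K x y t * f y)) @[t --> 0^'+] --> f x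
}.

Record graph (T : choiceType) := Graph {
  vertices : {fset T} ;
  adj : rel T ;
  adj_sym : symmetric adj ;
  adj_vertices : forall u v, adj u v ->
    (u \in vertices) && (v \in vertices) }.

Section voronoi.
Context (R : realType) (n : nat).
Variables (Omega : set 'rV[R]_n) (G : graph 'rV[R]_n).

Definition voronoi (v : 'rV[R]_n) : set 'rV[R]_n :=
  [set x | Omega x /\ forall v', v' \in vertices G -> v' != v ->
             eucl_dist x v < eucl_dist x v'].

Definition voronoi_collar (delta : R) (v : 'rV[R]_n) : set 'rV[R]_n :=
  [set x | voronoi v x /\ set_dist x (boundary (voronoi v)) < delta].

Definition cell_mass (v : 'rV[R]_n) : R := fine (lebesgue_rV R n (voronoi v)).

Definition admissible_width (eps delta : R) :=
  forall v, v \in vertices G ->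
    voronoi v `\` voronoi_collar delta v !=set0 /\
    (lebesgue_rV R n (voronoi_collar delta v)
       < (eps / (size (vertices G))%:R)%:E)%E.

Record cutoff_family (delta : R) (eta : 'rV[R]_n -> 'rV[R]_n -> R) : Prop :=
    CutoffFamily {
  cutoff_smooth : forall v, v \in vertices G -> smooth_on Omega (eta v) ;
  cutoff_ge0 : forall v x, v \in vertices G -> Omega x -> 0 <= eta v x ;
  cutoff_out : forall v x, v \in vertices G -> Omega x ->
    ~ voronoi v x -> eta v x = 0 ;
  cutoff_in : forall v x, v \in vertices G ->
    voronoi v x -> ~ voronoi_collar delta v x -> eta v x = 1 ;
  cutoff_collar : forall v x, v \in vertices G ->
    voronoi_collar (delta / 2) v x -> eta v x = 0 ;
  cutoff_mass : forall v, v \in vertices G ->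
    \int[lebesgue_rV R n]_(x in Omega) (eta v x ^+ 2) = cell_mass v }.

Definition H0 (K : 'rV[R]_n -> 'rV[R]_n -> R -> R)
    (eta : 'rV[R]_n -> 'rV[R]_n -> R) (v1 v2 : 'rV[R]_n) (t : R) : R :=
  (Num.sqrt (cell_mass v1 * cell_mass v2))^-1 *
  \int[lebesgue_rV R n]_(x in voronoi v1)
    \int[lebesgue_rV R n]_(y in voronoi v2) (K x y t * eta v1 x * eta v2 y).

End voronoi.

(* Main.v *)
Require Import Defs.
From HB Require Import structures.
From mathcomp Require Import all_boot all_order all_algebra finmap.
From mathcomp Require Import all_classical all_reals all_analysis.
From mathcomp Require Import measurable_realfun ring lra.

Set Implicit Arguments.
Unset Strict Implicit.
Unset Printing Implicit Defensive.

Import Order.TTheory GRing.Theory Num.Theory.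
Import numFieldNormedType.Exports.

Local Open Scope classical_set_scope.
Local Open Scope ring_scope.

(** Fix the pole [x] and write [u t = K x ^~ t].  For a convex C^2 function [f]
    vanishing on a neighbourhood of [0], [f (u t)] is compactly supported in
    [Omega] because of the Dirichlet condition, so an integration by parts gives
    [d/dt \int f (u t) = - \int f'' (u t) |grad u t|^2 <= 0].  Letting [f] tend
    to the identity, and using that the mass of [u t] tends to [1] as [t -> 0],
    one gets [\int_Omega K x y t dy <= 1] without any regularity of [K] at the
    boundary.

    Integrating by parts against a test function [phi] then shows that
    [P_t phi x = \int K x y t * phi y dy] satisfies [d/dt P_t phi = P_t (Lap phi)]
    and [|P_t phi| <= sup |phi|].  As the cut-off functions are test functions,
    the k-th derivative of [H0] is, up to the normalising factor, the integral
    of [eta v1 * P_t (Lap^k (eta v2))], which is bounded; and dominated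
    convergence gives the limit [\int eta v1 * eta v2] at [t = 0]. *)

(** * Lebesgue measure on row vectors *)

Section measure_rV.
Context {R : realType}.

Lemma measurable_box_rV n (A : 'I_n -> set (measurableTypeR R)) :
  (forall i, measurable (A i)) ->
  measurable [set x : 'rV[R]_n | forall i, A i (x ord0 i)].
Proof.
move=> mA; rewrite [X in measurable X](_ : _ = \big[setI/setT]_(i < n)
    ((fun x : 'rV[R]_n => x ord0 i : measurableTypeR R) @^-1` A i)).
  apply: bigsetI_measurable => i _.
  by rewrite -[X in measurable X]setTI; exact: measurable_coord_rV.
apply/seteqP; split=> x.
  by move=> Ax; rewrite -bigcap_seq => i _; exact: Ax.
by rewrite -bigcap_seq => Ax i; apply: Ax; rewrite /= mem_index_enum.
Qed.

Lemma ball_rVE n (x : 'rV[R]_n) (e : R) : 0 < e ->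
  ball x e = [set y | forall i, ball (x ord0 i) e (y ord0 i)].
Proof.
move=> e0; apply/seteqP; split=> y; first by move=> [_ xy] i; exact: xy.
by move=> xy; split=> // i j; rewrite ord1; exact: xy.
Qed.

Lemma measurable_ball_rV n (x : 'rV[R]_n) (e : R) : 0 < e ->
  measurable (ball x e).
Proof.
move=> e0; rewrite ball_rVE//.
apply: (measurable_box_rV (A := fun i => ball (x ord0 i) e)) => i.
by apply: open_measurable; exact: ball_open.
Qed.

Lemma ratr_rV_dense n (x : 'rV[R]_n) (e : R) : 0 < e ->
  exists q : 'rV[rat]_n, ball x e (map_mx ratr q).
Proof.
move=> e0.
have /choice[q qP] (i : 'I_n) : exists q : rat, ball (x ord0 i) e (ratr q).
  have : x ord0 i - e < x ord0 i + e by lra.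
  move=> /rat_in_itvoo[q]; rewrite in_itv/= => /andP[q1 q2]; exists q.
  by rewrite /ball/= ltr_distlC q1.
by exists (\row_i q i); rewrite ball_rVE// => i /=; rewrite !mxE.
Qed.

(** The sigma-algebra is generated by the coordinate maps, so [U] is written as a countable union of
    sup-norm balls, which are boxes, with rational centres and radii [k.+1%:R^-1]. *)
Lemma open_measurable_rV n (U : set 'rV[R]_n) : open U -> measurable U.
Proof.
move=> oU.
pose B (p : 'rV[rat]_n * nat) := ball (map_mx ratr p.1 : 'rV[R]_n) p.2.+1%:R^-1.
have -> : U = \bigcup_(p in [set p | B p `<=` U]) B p.
  apply/seteqP; split; last by move=> x [p /= pU]; exact: pU.
  move=> x Ux; have /nbhs_ballP[e /= e0 xU] : nbhs x U by exact: open_nbhs_nbhs.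
  have [k /= ke] : exists k : nat, k.+1%:R^-1 < e / 2.
    have e20 : 0 < e / 2 by rewrite divr_gt0.
    have [N _ /(_ N (leqnn N))] := near_infty_natSinv_lt (PosNum e20).
    by move=> ?; exists N.
  have k0 : 0 < k.+1%:R^-1 :> R by rewrite invr_gt0.
  have [q xq] := ratr_rV_dense x k0.
  exists (q, k); last by rewrite /B/=; exact: ball_sym.
  move=> y /= qy; apply: xU; rewrite (splitr e); apply: ball_triangle.
    by apply: le_ball xq; exact: ltW.
  by apply: le_ball qy; exact: ltW.
rewrite bigcup_mkcond; apply: countable_bigcupT_measurable => // p.
by case: ifPn => // _; apply: measurable_ball_rV; rewrite invr_gt0.
Qed.

Lemma open_continuous_measurable_rV n (D : set 'rV[R]_n) (f : 'rV[R]_n -> R) :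
  open D -> (forall x, D x -> {for x, continuous f}) -> measurable_fun D f.
Proof.
move=> oD cf; apply: (measurability _ (RGenOpens.measurableE R)).
move=> _ [_ [a [b ->]] <-]; apply: open_measurable_rV.
rewrite openE => x [Dx fx]; apply: filterI; first exact: open_nbhs_nbhs.
by apply: cf => //; apply: open_nbhs_nbhs; split => //; exact: interval_open.
Qed.

Lemma lebesgue_rV_ball n (x : 'rV[R]_n) (e : R) : 0 < e ->
  lebesgue_rV R n (ball x e) = ((e *+ 2) ^+ n)%:E.
Proof.
move=> e0; rewrite ball_rVE//.
rewrite (lebesgue_rV_box (A := fun i => ball (x ord0 i) e)); last first.
  by move=> i; apply: open_measurable; exact: ball_open.
under eq_bigr do rewrite lebesgue_measure_ball ?ltW//.
by rewrite prodEFin prodr_const card_ord.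
Qed.

Lemma lebesgue_rV_open_gt0 n (U : set 'rV[R]_n) (x : 'rV[R]_n) :
  open U -> U x -> (0 < lebesgue_rV R n U)%E.
Proof.
move=> oU Ux; have /nbhs_ballP[e /= e0 xU] : nbhs x U by exact: open_nbhs_nbhs.
apply: (@lt_le_trans _ _ (lebesgue_rV R n (ball x e))).
  by rewrite lebesgue_rV_ball// lte_fin exprn_gt0// mulrn_wgt0.
apply: le_measure; rewrite ?inE//; first exact: measurable_ball_rV.
exact: open_measurable_rV.
Qed.

Lemma lebesgue_rV_bounded n (A : set 'rV[R]_n) :
  measurable A -> bounded_set A -> (lebesgue_rV R n A < +oo)%E.
Proof.
move=> mA [M [_ AM]].
(* [bounded_set] bounds the norm by every number above [M], here by [|M| + 1]; one more unit gives
   an open ball containing [A]. *)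
pose e := `|M| + 2.
have e0 : 0 < e by rewrite /e; have := normr_ge0 M; lra.
apply: (@le_lt_trans _ _ (lebesgue_rV R n (ball (0 : 'rV[R]_n) e))); last first.
  by rewrite lebesgue_rV_ball// ltry.
apply: le_measure; rewrite ?inE//; first exact: measurable_ball_rV.
move=> x Ax; rewrite -ball_normE /ball_/= sub0r normrN.
have : `|x| <= `|M| + 1 by apply: (AM _ _ x Ax); have := ler_norm M; lra.
by rewrite /e; lra.
Qed.

End measure_rV.

(** * Integration by parts on R^n *)

Section integral_pderiv.
Context {R : realType}.

(** The two difference quotients are the same function of [k], so a derivative of [f] in the single
    direction [v] is enough. *)
Lemma is_derive_affine (U V W : normedModType R) (phi : U -> V) (f : V -> W)
    (a w : U) (v : V) (df : W) :
  (forall k : R, phi (k *: w + a) = k *: v + phi a) ->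
  is_derive (phi a) v f df -> is_derive a w (f \o phi) df.
Proof.
move=> phiE [dfv dfE].
have E : (fun k => k^-1 *: ((f \o phi \o shift a) (k *: w) - (f \o phi) a)) =
    (fun k => k^-1 *: ((f \o shift (phi a)) (k *: v) - f (phi a))).
  by apply/funext => k /=; rewrite phiE.
by split; rewrite /derivable/derive E.
Qed.

(** The fundamental theorem of calculus on [[-N, N]] with [N > M], where [f] vanishes at both ends;
    outside the segment [df] vanishes because [f] is locally zero. *)
Lemma integral_derive_eq0 (f df : R -> R) (M : R) :
  (forall x : R, is_derive x (1 : R) f (df x)) -> continuous df ->
  (forall x, M < `|x| -> f x = 0) ->
  (\int[lebesgue_measure]_x (df x)%:E = 0)%E.
Proof.
move=> fdf cdf f0.
pose N := `|M| + 1; have MN : M < N by rewrite /N; have := ler_norm M; lra.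
have N0 : 0 < N by rewrite /N; have := normr_ge0 M; lra.
have df0 x : M < `|x| -> df x = 0.
  move=> Mx; have [_ <-] := fdf x.
  rewrite (@near_eq_derive _ _ _ _ (cst 0)) ?derive_cst//.
  have : \forall y \near x, M < `|y|.
    exact: (@cvgr_norm_gt _ _ _ (nbhs x) _ id x cvg_id M Mx).
  by apply: filterS => y /f0.
have -> : (\int[lebesgue_measure]_x (df x)%:E =
          \int[lebesgue_measure]_(x in `[(- N)%R, N]) (df x)%:E)%E.
  rewrite [RHS]integral_mkcond; apply: eq_integral => x _.
  rewrite patchE; case: ifPn => // /negP xN; rewrite df0//.
  rewrite (lt_le_trans MN)// leNgt; apply/negP => xN'; apply: xN.
  by rewrite inE/= in_itv/=; move: xN'; rewrite ltr_norml => /andP[/ltW -> /ltW].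
have cf : continuous f.
  move=> x; apply: differentiable_continuous.
  by apply/derivable1_diffP; case: (fdf x).
rewrite (@continuous_FTC2 _ df f)//.
- rewrite f0 ?f0 ?subee// ?normrN gtr0_norm//.
- by rewrite ltrNl; lra.
- by apply: continuous_subspaceT.
- split.
  + by move=> x _; case: (fdf x).
  + by apply: cvg_at_right_filter; exact: cf.
  + by apply: cvg_at_left_filter; exact: cf.
- by move=> x _; rewrite derive1E; case: (fdf x).
Qed.

Lemma rV_cons0 n (p : measurableTypeR R * 'rV[R]_n) : rV_cons p ord0 ord0 = p.1.
Proof. exact: (congr1 fst (rV_consK p)). Qed.

Lemma rV_consS n (p : measurableTypeR R * 'rV[R]_n) j :
  rV_cons p ord0 (lift ord0 j) = p.2 ord0 j.
Proof.
have /rowP/(_ j) := congr1 snd (rV_consK p).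
by rewrite /rV_uncons/= mxE.
Qed.

Lemma rV_consP n (p : measurableTypeR R * 'rV[R]_n) (x : 'rV[R]_n.+1) :
  x ord0 ord0 = p.1 -> (forall j, x ord0 (lift ord0 j) = p.2 ord0 j) ->
  rV_cons p = x.
Proof.
move=> x0 xS; apply/rowP => i; case: (unliftP ord0 i) => [j|] ->.
  by rewrite rV_consS xS.
by rewrite rV_cons0 x0.
Qed.

Lemma delta_rVE n (i j : 'I_n) (k : R) (x : 'rV[R]_n) :
  (k *: delta_mx ord0 i + x) ord0 j = k * (j == i)%:R + x ord0 j.
Proof. by rewrite !mxE. Qed.

Lemma cvg_rV (T : Type) (F : set_system T) n (f : T -> 'rV[R]_n)
    (l : 'rV[R]_n) : Filter F ->
  (forall i, f y ord0 i @[y --> F] --> l ord0 i) -> f y @[y --> F] --> l.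
Proof.
move=> FF cf; apply/cvg_ballP => e e0.
have : \forall y \near F, forall i, ball (l ord0 i) e (f y ord0 i).
  by apply: filter_forall => i; have /cvg_ballP/(_ e e0) := cf i.
by apply: filterS => y fy; rewrite ball_rVE.
Qed.

Lemma coord_continuous_rV n (i : 'I_n) :
  continuous (fun x : 'rV[R]_n => x ord0 i).
Proof. exact: coord_continuous. Qed.

Lemma box_integrable n (g : 'rV[R]_n -> R) (M : R) :
  continuous g -> (forall (x : 'rV[R]_n) i, M < `|x ord0 i| -> g x = 0) ->
  (lebesgue_rV R n).-integrable setT (EFin \o g).
Proof.
move=> cg g0.
pose B := [set x : 'rV[R]_n | forall i, `[(- M), M]%classic (x ord0 i)].
have mB : measurable B.
  by apply: (measurable_box_rV (A := fun _ => `[(- M), M]%classic)).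
have cB : compact B.
  apply: (@rV_compact _ _ (fun=> `[(- M), M]%classic)) => _.
  exact: segment_compact.
have -> : EFin \o g = (EFin \o g) \_ B.
  apply/funext => x; rewrite patchE; case: ifPn => // /negP xB /=; congr EFin.
  have [i Mi] : exists i, M < `|x ord0 i|.
    apply: contrapT => h; apply: xB; rewrite inE => i /=.
    rewrite in_itv/= -ler_norml leNgt; apply/negP => Mi; apply: h; by exists i.
  exact: g0 Mi.
apply/(integrable_mkcond _ mB); apply: measurable_bounded_integrable => //.
- by apply: lebesgue_rV_bounded => //; exact: compact_bounded.
- apply: measurable_funTS; apply: open_continuous_measurable_rV.
    exact: openT.
  by move=> x _; exact: cg.
- have : compact (g @` B).
    by apply: continuous_compact => //; exact: continuous_subspaceT.
  move=> /compact_bounded[N [Nr hN]]; exists N; split => // k Nk x Bx.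
  by apply: (hN k Nk (g x)); exists x.
Qed.

(** [lebesgue_rV R n.+1] is by construction the pushforward of a product measure under [rV_cons];
    this change of variables opens the way to Fubini's theorem. *)
Lemma integral_lebesgue_step n (g : 'rV[R]_n.+1 -> \bar R) :
  (lebesgue_rV R n.+1).-integrable setT g ->
  (\int[lebesgue_rV R n.+1]_x g x =
   \int[lebesgue_measure \x lebesgue_rV R n]_p g (rV_cons p))%E /\
  ((lebesgue_measure \x lebesgue_rV R n)%E).-integrable setT (g \o @rV_cons R n).
Proof.
move=> /integrableP[mg gfin].
have mc := @measurable_rV_cons R n.
have mgc : measurable_fun setT (g \o @rV_cons R n).
  exact: measurableT_comp.
have ig : ((lebesgue_measure \x lebesgue_rV R n)%E).-integrable setT
    (g \o @rV_cons R n).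
  apply/integrableP; split => //; move: gfin => /=.
  rewrite [X in (X < _)%E -> _](_ : _ =
    \int[pushforward (lebesgue_measure \x lebesgue_rV R n) (@rV_cons R n)]_x
      `|g x|)%E //.
  rewrite ge0_integral_pushforward//.
  exact: measurableT_comp.
split => //.
rewrite [LHS](_ : _ =
    \int[pushforward (lebesgue_measure \x lebesgue_rV R n) (@rV_cons R n)]_x
      g x)%E //.
by rewrite integral_pushforward.
Qed.

(** Induction on the dimension, splitting off the first coordinate. Fubini's theorem lets the
    integral containing the direction [i] be taken first, and this inner integral is already
    zero. *)
Lemma integral_pderiv_eq0 n (i : 'I_n) (f df : 'rV[R]_n -> R) (M : R) :
  (forall x : 'rV[R]_n, is_derive x (delta_mx ord0 i) f (df x)) -> continuous df ->
  (forall (x : 'rV[R]_n) j, M < `|x ord0 j| -> f x = 0) ->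
  (\int[lebesgue_rV R n]_x (df x)%:E = 0)%E.
Proof.
elim: n i f df => [[]//|n IHn] i f df fdf cdf f0.
have df0 (x : 'rV[R]_n.+1) j : M < `|x ord0 j| -> df x = 0.
  move=> Mx; have [_ <-] := fdf x.
  rewrite (@near_eq_derive _ _ _ _ (cst 0)) ?derive_cst//.
  have : \forall y \near x, M < `|(y : 'rV[R]_n.+1) ord0 j|.
    exact: (@cvgr_norm_gt _ _ _ (nbhs x) _ (fun y : 'rV[R]_n.+1 => y ord0 j)
      (x ord0 j) (@coord_continuous_rV _ j x) M Mx).
  by apply: filterS => y /f0.
have [-> idf] := integral_lebesgue_step (box_integrable cdf df0).
case: (unliftP ord0 i) => [j|] iE; subst i.
(* The direction lies in the tail: for a fixed first coordinate [a], the induction hypothesis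
   applies to the slice. *)
- rewrite -(integral12_prod_meas1 idf) integral0_eq// => a _ /=.
  apply: (IHn j (f \o (fun v => rV_cons (a, v)))) => [v| |v k Mk].
  + apply: is_derive_affine (fdf _) => k.
    apply: rV_consP => [|j']; rewrite delta_rVE.
      by rewrite mulr0 add0r rV_cons0.
    by rewrite rV_consS (inj_eq lift_inj) delta_rVE.
  + move=> v; apply: continuous_comp; last exact: cdf.
    apply: (@cvg_rV _ (nbhs v)) => k; case: (unliftP ord0 k) => [k'|] ->.
      rewrite rV_consS; under eq_fun do rewrite rV_consS.
      exact: coord_continuous_rV.
    by rewrite rV_cons0; under eq_fun do rewrite rV_cons0; exact: cvg_cst.
  + by rewrite /= (f0 _ (lift ord0 k))// rV_consS.
(* The direction is the first coordinate: for a fixed tail [v], the one-variable case applies. *)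
- rewrite -(integral21_prod_meas1 idf) integral0_eq// => v _ /=.
  apply: (@integral_derive_eq0 (f \o (fun a => rV_cons (a, v))) _ M) => [a| |a Ma].
  + apply: is_derive_affine (fdf _) => k.
    apply: rV_consP => [|j']; rewrite delta_rVE.
      by rewrite rV_cons0.
    by rewrite rV_consS mulr0 add0r.
  + move=> a; apply: continuous_comp; last exact: cdf.
    apply: (@cvg_rV _ (nbhs a)) => k; case: (unliftP ord0 k) => [k'|] ->.
      by rewrite rV_consS; under eq_fun do rewrite rV_consS; exact: cvg_cst.
    by rewrite rV_cons0; under eq_fun do rewrite rV_cons0; exact: cvg_id.
  + by rewrite /= (f0 _ ord0)// rV_cons0.
Qed.

End integral_pderiv.

(** * Functions vanishing near the boundary of a bounded open set *)

Section flat.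
Context {R : realType} {n : nat}.
Variable Omega : set 'rV[R]_n.
Hypotheses (oO : open Omega) (bO : bounded_set Omega).

Definition continuous_on (f : 'rV[R]_n -> R) :=
  forall y, Omega y -> {for y, continuous f}.

(** The substitute for compact support in [Omega]. Values outside [Omega] are left free, because the
    kernel and the cut-off functions are constrained only inside. *)
Definition flat (f : 'rV[R]_n -> R) :=
  forall z, boundary Omega z -> \forall y \near z, Omega y -> f y = 0.

Lemma measurable_domain : measurable Omega.
Proof. exact: open_measurable_rV. Qed.

Lemma compact_closure_domain : compact (closure Omega).
Proof.
apply: bounded_closed_compact; last exact: closed_closure.
have [M [_ OM]] := bO.
pose N := `|M| + 1; have MN : M < N by rewrite /N; have := ler_norm M; lra.
exists N; split => [|k Nk x]; first exact: num_real.
have cB : closed [set y : 'rV[R]_n | `|y| <= N].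
  rewrite [X in closed X](_ : _ = Num.norm @^-1` [set r : R | r <= N]) //.
  by apply: closed_comp => [y _|]; [exact: norm_continuous|exact: closed_le].
move=> /(closure_subset (OM N MN : Omega `<=` [set y | `|y| <= N])).
by rewrite -(closure_id _).1// => /le_trans; apply; exact: ltW.
Qed.

Lemma closure_domain x : closure Omega x -> Omega x \/ boundary Omega x.
Proof.
move=> Ox; have [|nOx] := pselect (Omega x); first by left.
by right; split => // /interior_subset.
Qed.

Lemma boundaryNdomain x : boundary Omega x -> ~ Omega x.
Proof. by move=> [_ nOx] Ox; apply: nOx; exact: open_nbhs_nbhs. Qed.

(** Compactness of the closure of [Omega] makes a local statement uniform. Interior and boundary
    points have separate hypotheses: continuity serves the former, the Dirichlet condition or
    flatness the latter. *)
Lemma domain_near_covering (I : Type) (F : set_system I)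
    (P : I -> 'rV[R]_n -> Prop) :
  Filter F ->
  (forall y, Omega y -> \forall y' \near y & i \near F, P i y') ->
  (forall z, boundary Omega z ->
    \forall y \near z & i \near F, Omega y -> P i y) ->
  \forall i \near F, forall y, Omega y -> P i y.
Proof.
move=> FF PO PB.
have /compact_near_coveringP/(_ I F (fun i y => Omega y -> P i y) FF) :=
  compact_closure_domain.
have h x : closure Omega x -> \forall x' \near x & i \near F, Omega x' -> P i x'.
  move=> /closure_domain[/PO|/PB//].
  by apply: filterS => -[a b] /=.
move=> /(_ h); apply: filterS => i Pi y Oy; apply: Pi => //.
exact: subset_closure.
Qed.

Lemma param_bounded (T : topologicalType) (s0 : T) (g : 'rV[R]_n -> T -> R) (B : R) :
  (forall y, Omega y -> {for (y, s0), continuous (fun p => g p.1 p.2)}) ->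
  (forall z, boundary Omega z ->
    \forall y \near z & s \near s0, Omega y -> `|g y s| <= B) ->
  exists M, \forall s \near s0, forall y, Omega y -> `|g y s| <= M.
Proof.
move=> cg gB.
(* The bound is itself made a parameter tending to infinity, so that the covering argument yields
   one bound valid on all of [Omega]. *)
have : \forall p \near filter_prod (pinfty_nbhs R) (nbhs s0),
    forall y, Omega y -> `|g y p.2| <= p.1.
  apply: (@domain_near_covering _ _ (fun p y => `|g y p.2| <= p.1)) => [y Oy|z Bz].
    have h1 : \forall y' \near y & s \near s0, `|g y' s| < `|g y s0| + 1.
      have := @cvgr_norm_lt _ _ _ _ _ _ _ (cg _ Oy) (`|g y s0| + 1).
      by apply; rewrite ltrDl.
    have [[A C] /= [hA hC] AC] := h1.
    exists (A, [set p : R * T | `|g y s0| + 1 < p.1 /\ C p.2]) => /=.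
      split => //; exists ([set M | `|g y s0| + 1 < M], C) => /=.
        by split => //; exact: nbhs_pinfty_gt.
      by move=> [a b] /= [].
    move=> [y' [M s]] /= [Ay' [hM Cs]].
    by apply/ltW/(lt_trans _ hM); exact: (AC (y', s) (conj Ay' Cs)).
  have [[A C] /= [hA hC] AC] := gB _ Bz.
  exists (A, [set p : R * T | B < p.1 /\ C p.2]) => /=.
    split => //; exists ([set M | B < M], C) => /=.
      by split => //; apply: nbhs_pinfty_gt; exact: num_real.
    by move=> [a b] /= [].
  move=> [y' [M s]] /= [Ay' [hM Cs]] Oy'.
  by apply: (le_trans _ (ltW hM)); exact: (AC (y', s) (conj Ay' Cs) Oy').
move=> [[A C] /= [hA hC] AC].
have [M AM] := filter_ex hA.
by exists M; apply: filterS hC => s Cs y Oy; exact: (AC (M, s) (conj AM Cs)).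
Qed.

Lemma near_eq_continuous (T U : topologicalType) (f g : T -> U) (x : T) :
  (\forall y \near x, f y = g y) -> {for x, continuous f} ->
  {for x, continuous g}.
Proof.
move=> fg cf; rewrite /prop_for/continuous_at -(nbhs_singleton fg).
apply: cvg_trans cf; apply: near_eq_cvg; apply: filterS fg => y; exact.
Qed.

Lemma near_patch_in (f : 'rV[R]_n -> R) x : Omega x ->
  \forall y \near x, f y = (f \_ Omega) y.
Proof.
move=> Ox; have : \forall y \near x, Omega y by exact: open_nbhs_nbhs.
by apply: filterS => y Oy; rewrite patchE mem_set.
Qed.

(** A point outside [Omega] is either off the closure or on the boundary, where flatness applies.
    Extension by zero therefore keeps continuity and partial derivatives, and integration over the
    whole space becomes available. *)
Lemma near_patch_out (f : 'rV[R]_n -> R) x : flat f -> ~ Omega x ->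
  \forall y \near x, 0 = (f \_ Omega) y.
Proof.
move=> ff nOx; have [cx|ncx] := pselect (closure Omega x).
  have [//|/ff] := closure_domain cx.
  apply: filterS => y fy; rewrite patchE; case: ifPn => // /set_mem Oy.
  by rewrite fy.
have : \forall y \near x, (~` closure Omega) y.
  apply: open_nbhs_nbhs; split => //.
  by apply: closed_openC; exact: closed_closure.
apply: filterS => y ny; rewrite patchE; case: ifPn => // /set_mem Oy.
by exfalso; apply: ny; exact: subset_closure.
Qed.

Lemma patch_continuous f : continuous_on f -> flat f -> continuous (f \_ Omega).
Proof.
move=> cf ff x; have [Ox|nOx] := pselect (Omega x).
  exact: near_eq_continuous (near_patch_in f Ox) (cf _ Ox).
by apply: near_eq_continuous (near_patch_out ff nOx) _; exact: cst_continuous.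
Qed.

Lemma near_eq0_derive (V : normedModType R) (f : V -> R) (x v : V) :
  (\forall y \near x, f y = 0) -> 'D_v f x = 0.
Proof.
move=> f0; rewrite (near_eq_derive (g := cst 0))//; exact: derive_cst.
Qed.

Lemma flat_pderiv i f : flat f -> flat (pderiv i f).
Proof.
(* Passing to the interior gives the vanishing on a neighbourhood of each nearby [y], as
   differentiation at [y] requires. *)
move=> ff z /ff /nbhs_interior; apply: filterS => y /= fy Oy.
apply: near_eq0_derive.
have : \forall y \near y, Omega y by exact: open_nbhs_nbhs.
by apply: filterS2 fy => y' h; exact: h.
Qed.

Lemma patch_is_derive i f x :
  (forall y, Omega y -> derivable f y (delta_mx ord0 i)) ->
  flat f -> is_derive x (delta_mx ord0 i) (f \_ Omega) (pderiv i f \_ Omega x).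
Proof.
move=> df ff; have [Ox|nOx] := pselect (Omega x).
  apply: near_eq_is_derive (near_patch_in f Ox) _.
  by rewrite patchE mem_set//; apply: derivableP; exact: df.
apply: near_eq_is_derive (near_patch_out ff nOx) _.
rewrite patchE memNset//; exact: is_derive_cst.
Qed.

Lemma flat_integral_pderiv i f : continuous_on (pderiv i f) ->
  (forall y, Omega y -> derivable f y (delta_mx ord0 i)) -> flat f ->
  \int[lebesgue_rV R n]_(x in Omega) pderiv i f x = 0.
Proof.
move=> cf df ff; rewrite Rintegral_mkcond /Rintegral.
have [M [_ OM]] := bO.
have H := @integral_pderiv_eq0 _ _ i (f \_ Omega) _ (`|M| + 1)
  (fun x => patch_is_derive x df ff).
rewrite H//.
- by apply: patch_continuous => //; exact: flat_pderiv.
- move=> x j Mx; rewrite patchE; case: ifPn => // /set_mem Ox.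
  exfalso; move: Mx; apply/negP; rewrite -leNgt.
  apply: le_trans (OM (`|M| + 1) _ x Ox); last by have := ler_norm M; lra.
  rewrite [leRHS]/Num.Def.normr/= mx_normrE.
  exact: (@le_bigmax _ _ _ _ (fun ij => `|x ij.1 ij.2|) (ord0, j)).
Qed.

Lemma flat_bounded f : continuous_on f -> flat f ->
  exists M, forall y, Omega y -> `|f y| <= M.
Proof.
(* The parametric bound is applied with a dummy real parameter, at [0]. *)
move=> cf ff; have [|z Bz|M hM] := @param_bounded R 0 (fun y _ => f y) 0.
- move=> y Oy /=; apply: (@continuous_comp _ _ _ fst f); first exact: cvg_fst.
  exact: cf.
- have := ff _ Bz; move=> h; exists (fun y => Omega y -> f y = 0, setT) => /=.
    by split => //; exact: filterT.
  by move=> [y s] /= [fy _] Oy; rewrite fy// normr0.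
- by exists M; have := nbhs_singleton hM.
Qed.

Lemma integrable_on f M : continuous_on f -> (forall y, Omega y -> `|f y| <= M) ->
  (lebesgue_rV R n).-integrable Omega (EFin \o f).
Proof.
move=> cf fM; apply: measurable_bounded_integrable.
- exact: measurable_domain.
- by apply: lebesgue_rV_bounded => //; exact: measurable_domain.
- exact: open_continuous_measurable_rV.
- exists M; split => [|k Mk x Ox]; first exact: num_real.
  by apply: le_trans (fM _ Ox) _; exact: ltW.
Qed.

Lemma flat_integrable f : continuous_on f -> flat f ->
  (lebesgue_rV R n).-integrable Omega (EFin \o f).
Proof. by move=> cf ff; have [M] := flat_bounded cf ff; exact: integrable_on. Qed.

(** The divergence theorem for a vector field that vanishes near the boundary, hence without
    boundary term and without regularity of the boundary. *)
Lemma flat_integral_sum_pderiv (F : 'I_n -> 'rV[R]_n -> R) :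
  (forall i, continuous_on (pderiv i (F i))) ->
  (forall i y, Omega y -> derivable (F i) y (delta_mx ord0 i)) ->
  (forall i, flat (F i)) ->
  (lebesgue_rV R n).-integrable Omega
    (EFin \o (fun x => \sum_(i < n) pderiv i (F i) x)) /\
  \int[lebesgue_rV R n]_(x in Omega) (\sum_(i < n) pderiv i (F i) x) = 0.
Proof.
move=> cF dF fF.
suff H (s : seq 'I_n) : (lebesgue_rV R n).-integrable Omega
      (EFin \o (fun x => \sum_(i <- s) pderiv i (F i) x)) /\
    \int[lebesgue_rV R n]_(x in Omega) (\sum_(i <- s) pderiv i (F i) x) = 0.
  exact: H.
elim: s => [|i s [is0 s0]].
  under eq_fun do rewrite big_nil; split; last first.
    by rewrite Rintegral_cst ?mul0r//; exact: measurable_domain.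
  exact: integrable0.
have ii : (lebesgue_rV R n).-integrable Omega (EFin \o pderiv i (F i)).
  by apply: flat_integrable => //; exact: flat_pderiv.
have -> : (fun x => \sum_(i <- i :: s) pderiv i (F i) x) =
    (fun x => pderiv i (F i) x + \sum_(i <- s) pderiv i (F i) x).
  by apply/funext => x; rewrite big_cons.
split.
  have := integrableD measurable_domain ii is0.
  by apply: eq_integrable => //; exact: measurable_domain.
rewrite RintegralD//; last exact: measurable_domain.
by rewrite s0 flat_integral_pderiv ?addr0//; exact: dF.
Qed.

End flat.

(** * Integrals over the domain depending on a parameter *)

Section param_integral.
Context {R : realType} {n : nat}.
Variable Omega : set 'rV[R]_n.
Hypotheses (oO : open Omega) (bO : bounded_set Omega).
Let mO := measurable_domain oO.

(** Flatness locally uniform in the parameter: one neighbourhood of [z] serves all [s] near [s0]. *)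
Definition near_flat (T : topologicalType) (s0 : T) (g : 'rV[R]_n -> T -> R) :=
  forall z, boundary Omega z -> \forall y \near z & s \near s0, Omega y -> g y s = 0.

Lemma near_flat_slice (T : topologicalType) (s0 : T) (g : 'rV[R]_n -> T -> R) :
  near_flat s0 g -> flat Omega (g ^~ s0).
Proof.
move=> fg z /fg[[A C] /= [hA hC] AC].
apply: filterS hA => y Ay; apply: (AC (y, s0)); split => //=.
exact: nbhs_singleton.
Qed.

Lemma Rintegral_bound (f : 'rV[R]_n -> R) M :
  continuous_on Omega f -> (forall y, Omega y -> `|f y| <= M) ->
  `|\int[lebesgue_rV R n]_(y in Omega) f y| <= M * fine (lebesgue_rV R n Omega).
Proof.
move=> cf fM; have If := integrable_on oO bO cf fM.
apply: le_trans (le_normr_Rintegral mO If) _.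
rewrite -Rintegral_cst//; apply: le_Rintegral => //.
- exact: integrable_norm.
- by apply: (@integrable_on _ _ _ oO bO _ `|M|) => // y Oy; exact: cst_continuous.
Qed.

Lemma param_flat_bounded (T : topologicalType) (s0 : T) (g : 'rV[R]_n -> T -> R) :
  (forall y, Omega y -> {for (y, s0), continuous (fun p => g p.1 p.2)}) ->
  near_flat s0 g ->
  exists M, \forall s \near s0, forall y, Omega y -> `|g y s| <= M.
Proof.
move=> cg fg.
have h z : boundary Omega z ->
    \forall y \near z & s \near s0, Omega y -> `|g y s| <= 0.
  move=> /fg.
  by apply: filterS => -[y s] /= h Oy; rewrite h// normr0.
exact: (param_bounded bO cg h).
Qed.

(** The integrands converge uniformly on [Omega]: by joint continuity around interior points, and
    because both sides vanish near the boundary. *)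
Lemma param_integral_cvg (T : topologicalType) (s0 : T) (g : 'rV[R]_n -> T -> R) :
  (forall y, Omega y -> {for (y, s0), continuous (fun p => g p.1 p.2)}) ->
  near_flat s0 g ->
  (\forall s \near s0, continuous_on Omega (g ^~ s)) ->
  (\int[lebesgue_rV R n]_(y in Omega) g y s) @[s --> s0] -->
  \int[lebesgue_rV R n]_(y in Omega) g y s0.
Proof.
move=> cg fg cs; have [M hM] := param_flat_bounded cg fg.
set V := fine (lebesgue_rV R n Omega).
have V0 : 0 <= V by exact: fine_ge0.
apply/cvgrPdist_le => e e0.
pose d := e / (V + 1); have d0 : 0 < d by rewrite divr_gt0// ltr_wpDl.
have dV : d * V <= e.
  by rewrite /d mulrAC ler_pdivrMr ?ltr_wpDl// ler_pM2l//; lra.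
have H : \forall s \near s0, forall y, Omega y -> `|g y s0 - g y s| <= d.
  apply: (@domain_near_covering _ _ _ bO _ _
    (fun s y => `|g y s0 - g y s| <= d)) => [y Oy|z Bz].
    have h : \forall p \near (y, s0), `|g y s0 - g p.1 p.2| < d / 2.
      by move/cvgrPdist_lt : (cg _ Oy); apply; rewrite divr_gt0.
    have h0 : \forall y' \near y & s \near s0, `|g y s0 - g y' s0| < d / 2.
      have [[A C] /= [hA hC] AC] := h.
      exists (A, setT); first by split => //; exact: filterT.
      move=> [y' s] /= [Ay' _]; apply: (AC (y', s0)); split => //=.
      exact: nbhs_singleton.
    apply: filterS2 h h0 => -[y' s] /= h1 h2.
    have -> : g y' s0 - g y' s = (g y s0 - g y' s) - (g y s0 - g y' s0) by ring.
    by apply: le_trans (ler_normB _ _) _; lra.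
  have [[A C] /= [hA hC] AC] := fg _ Bz.
  exists (A, C) => // -[y s] /= [Ay Cs] Oy.
  rewrite (AC (y, s) (conj Ay Cs) Oy) (AC (y, s0) (conj Ay (nbhs_singleton hC)) Oy).
  by rewrite subrr normr0 ltW.
have cs0 := nbhs_singleton cs; have M0 := nbhs_singleton hM.
apply: filterS3 hM cs H => s sM css sd.
rewrite -RintegralB//; [|exact: integrable_on cs0 M0|exact: integrable_on css sM].
apply: le_trans dV; apply: Rintegral_bound => // y Oy.
by apply: (@cvgB _ _ _ (nbhs y)); [exact: cs0|exact: css].
Qed.

(** By compactness [g1] is bounded by one constant for all parameters near [t0]; as [Omega] has
    finite measure, that constant is an integrable dominating function. *)
Lemma param_integral_is_derive (t0 : R) (g g1 : 'rV[R]_n -> R -> R) :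
  (forall y, Omega y -> {for (y, t0), continuous (fun p => g p.1 p.2)}) ->
  (forall y, Omega y -> {for (y, t0), continuous (fun p => g1 p.1 p.2)}) ->
  near_flat t0 g -> near_flat t0 g1 ->
  (\forall s \near t0, continuous_on Omega (g ^~ s)) ->
  (\forall s \near t0, forall y, Omega y -> is_derive s (1 : R) (g y) (g1 y s)) ->
  is_derive t0 (1 : R) (fun t => \int[lebesgue_rV R n]_(y in Omega) g y t)
    (\int[lebesgue_rV R n]_(y in Omega) g1 y t0).
Proof.
move=> cg cg1 fg fg1 cs ds.
have [M hM] := param_flat_bounded cg fg.
have [N hN] := param_flat_bounded cg1 fg1.
have : \forall s \near t0, [/\ continuous_on Omega (g ^~ s),
    (forall y, Omega y -> is_derive s (1 : R) (g y) (g1 y s)),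
    (forall y, Omega y -> `|g y s| <= M) & forall y, Omega y -> `|g1 y s| <= N].
  by apply: filterS2 (filterI cs ds) (filterI hM hN) => s [? ?] [? ?]; split.
move=> /nbhs_ballP[e /= e0 he].
have I s : `]t0 - e, t0 + e[%classic s -> ball t0 e s.
  by rewrite /= in_itv/= /ball/= ltr_distlC => ->.
have I0 : `]t0 - e, t0 + e[%classic t0 by rewrite /= in_itv/=; lra.
have i1 x : `]t0 - e, t0 + e[%classic x ->
    (lebesgue_rV R n).-integrable Omega (EFin \o (g ^~ x)).
  by move=> /I/he[cx _ gM _]; exact: integrable_on gM.
have i2 x y : `]t0 - e, t0 + e[%classic x -> Omega y -> derivable (g y) x 1.
  by move=> /I/he[_ dg _ _] /dg[].
(* The absolute value is taken because [N] is not known to be non-negative. *)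
have i3 : (lebesgue_rV R n).-integrable Omega (EFin \o (fun=> `|N|)).
  apply: (@integrable_on _ _ _ oO bO _ `|N|) => y Oy; first exact: cst_continuous.
  by rewrite normr_id.
have i4 x y : `]t0 - e, t0 + e[%classic x -> Omega y ->
    `|partial1of2 (fun t y => g y t) x y| <= `|N|.
  rewrite partial1of2E => /I/he[_ dg _ g1N] Oy.
  have [_ ->] := dg _ Oy; apply: le_trans (g1N _ Oy) _; exact: ler_norm.
have D := @derivable_under_integral R _ _ (lebesgue_rV R n) (fun t y => g y t)
  _ mO _ _ _ I0 i1 i2 _ (fun y => normr_ge0 N) i3 i4.
have DE := @differentiation_under_integral R _ _ (lebesgue_rV R n) (fun t y => g y t)
  _ mO _ _ _ I0 i1 i2 _ (fun y => normr_ge0 N) i3 i4.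
apply: DeriveDef => //; rewrite -derive1E DE.
apply: eq_Rintegral => y /set_mem Oy; rewrite partial1of2E.
by have [_ /(_ y Oy)[]] := he _ (I _ I0).
Qed.

End param_integral.

(** * A convex truncation *)

Section smooth_shrink.
Context {R : realType}.

Lemma is_derive_line (V W : normedModType R) (f : V -> W) (x v : V) (df : W) :
  is_derive (0 : R) (1 : R) (fun h => f (h *: v + x)) df -> is_derive x v f df.
Proof.
have E : (fun h => h^-1 *: (((fun k => f (k *: v + x)) \o shift 0) (h *: (1 : R)) -
      f (0 *: v + x))) = (fun h => h^-1 *: ((f \o shift x) (h *: v) - f x)).
  by apply/funext => h /=; rewrite addr0 scale0r add0r [_%:A]mulr1.
by move=> [d e]; split; move: d e; rewrite /derivable/derive E.
Qed.

(** Restriction to the line through [x] in the direction [v] reduces this to the one-variable chain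
    rule, so [f] needs only a directional derivative. *)
Lemma is_derive_scalar_comp (V : normedModType R) (phi : R -> R) (f : V -> R)
    (x v : V) (df dphi : R) :
  is_derive (f x) (1 : R) phi dphi -> is_derive x v f df ->
  is_derive x v (phi \o f) (dphi * df).
Proof.
move=> Dphi Df; apply: is_derive_line.
have Dg : is_derive (0 : R) (1 : R) (f \o (fun h => h *: v + x)) df.
  apply: (@is_derive_affine _ _ _ _ (fun h : R => h *: v + x) f 0 1 v) => [k|].
    by rewrite addr0 scale0r add0r [_%:A]mulr1.
  by rewrite scale0r add0r.
apply: (@is_derive1_comp R phi (f \o (fun h => h *: v + x)) 0) => /=.
by rewrite scale0r add0r.
Qed.

Lemma is_derive_glue (f df : R -> R) (e : R) : f e = 0 -> df e = 0 ->
  (forall s, e <= s -> is_derive s (1 : R) f (df s)) ->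
  forall s, is_derive s (1 : R) (fun r => f (Num.max r e)) (df (Num.max s e)).
Proof.
move=> fe dfe fdf s; have [se|es|->] := ltgtP s e.
- have D0 : is_derive s (1 : R) (cst (0 : R)) 0 by exact: is_derive_cst.
  rewrite dfe; apply: near_eq_is_derive D0.
  have : \forall r \near s, r < e by exact: lt_nbhsl.
  by apply: filterS => r re; rewrite max_r ?fe// ltW.
- apply: near_eq_is_derive (fdf _ (ltW es)).
  have : \forall r \near s, e < r by exact: lt_nbhsr.
  by apply: filterS => r re; rewrite max_l// ltW.
(* At the junction the glued quotient is [0] for [h < 0] and that of [f] otherwise; it is thus
   dominated by the quotient of [f], which tends to [df e = 0]. *)
- have [De DeE] := fdf e (lexx e).
  suff H : (h^-1 *: (f (Num.max (h *: (1 : R) + e) e) - f (Num.max e e)))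
      @[h --> 0^'] --> (0 : R).
    rewrite dfe; split; first by apply/cvg_ex; exists 0.
    exact: cvg_lim H.
  have K : (h^-1 *: (f (h *: (1 : R) + e) - f e)) @[h --> 0^'] --> df e.
    by rewrite -DeE; exact: De.
  rewrite dfe in K.
  apply/cvgr0Pnorm_lt => d d0.
  have /cvgr0Pnorm_lt/(_ d d0) := K; apply: filterS => h.
  rewrite maxxx !fe !subr0; apply: le_lt_trans.
  rewrite !normrZ ler_wpM2l//; have [_|_] := ltP (h *: (1 : R) + e) e => //.
  by rewrite fe normr0.
Qed.

(* For [s >= e], [shrink e s = (s - e) ^ 3 / s ^ 2], and [shrink1 e], [shrink2 e]
   are the first two derivatives; all three vanish for [s <= e]. *)
Definition shrink (e s : R) : R := (Num.max s e - e) ^+ 3 * (Num.max s e)^-1 ^+ 2.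
Definition shrink1 (e s : R) : R :=
  1 - 3 * e ^+ 2 * (Num.max s e)^-1 ^+ 2 + 2 * e ^+ 3 * (Num.max s e)^-1 ^+ 3.
Definition shrink2 (e s : R) : R :=
  6 * e ^+ 2 * (Num.max s e - e) * (Num.max s e)^-1 ^+ 4.

Variable e : R.
Hypothesis e0 : 0 < e.

Lemma shrink_is_derive s : is_derive s (1 : R) (shrink e) (shrink1 e s).
Proof.
apply: (@is_derive_glue (fun m => (m - e) ^+ 3 * m^-1 ^+ 2)
  (fun m => 1 - 3 * e ^+ 2 * m^-1 ^+ 2 + 2 * e ^+ 3 * m^-1 ^+ 3)) => [||m em].
- by rewrite subrr expr0n mul0r.
- by field; rewrite gt_eqF.
- have m0 : m != 0 by rewrite gt_eqF// (lt_le_trans e0).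
  have Dv : is_derive m (1 : R) (fun x => x^-1) (- m ^- 2).
    by apply: is_derive_eq; first exact: is_deriveV; rewrite [_ *: _]mulr1.
  apply: is_derive_eq; rewrite /GRing.scale/=; by field.
Qed.

Lemma shrink1_is_derive s : is_derive s (1 : R) (shrink1 e) (shrink2 e s).
Proof.
apply: (@is_derive_glue
  (fun m => 1 - 3 * e ^+ 2 * m^-1 ^+ 2 + 2 * e ^+ 3 * m^-1 ^+ 3)
  (fun m => 6 * e ^+ 2 * (m - e) * m^-1 ^+ 4)) => [||m em].
- by field; rewrite gt_eqF.
- by rewrite subrr mulr0 mul0r.
- have m0 : m != 0 by rewrite gt_eqF// (lt_le_trans e0).
  have Dv : is_derive m (1 : R) (fun x => x^-1) (- m ^- 2).
    by apply: is_derive_eq; first exact: is_deriveV; rewrite [_ *: _]mulr1.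
  apply: is_derive_eq; rewrite /GRing.scale/=; by field.
Qed.

Lemma is_derive_continuous (f : R -> R) (x d : R) :
  is_derive x (1 : R) f d -> {for x, continuous f}.
Proof.
by move=> [df _]; apply: differentiable_continuous; apply/derivable1_diffP.
Qed.

Lemma shrink_continuous : continuous (shrink e).
Proof. by move=> s; exact: (is_derive_continuous (shrink_is_derive s)). Qed.

Lemma shrink1_continuous : continuous (shrink1 e).
Proof. by move=> s; exact: (is_derive_continuous (shrink1_is_derive s)). Qed.

Lemma max_gt0 s : 0 < Num.max s e.
Proof. by rewrite lt_max e0 orbT. Qed.

Lemma shrink2_continuous : continuous (shrink2 e).
Proof.
have cm : continuous (fun s => Num.max s e).
  by move=> s; apply: continuous_max; [exact: cvg_id|exact: cvg_cst].
move=> s; apply: cvgM.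
  apply: cvgM; first exact: cvg_cst.
  by apply: cvgB; [exact: cm|exact: cvg_cst].
apply: (@continuous_comp _ _ _ (fun s => (Num.max s e)^-1) (fun x => x ^+ 4)).
  by apply: cvgV; [rewrite gt_eqF// max_gt0|exact: cm].
exact: exprn_continuous.
Qed.

(** Convexity of the truncation: this sign makes the truncated mass decrease in time. *)
Lemma shrink2_ge0 s : 0 <= shrink2 e s.
Proof.
apply: mulr_ge0; first apply: mulr_ge0.
- by rewrite mulr_ge0// exprn_ge0// ltW.
- by rewrite subr_ge0 le_max lexx orbT.
- by rewrite exprn_ge0// invr_ge0 ltW// max_gt0.
Qed.

Lemma shrink_eq0 s : s <= e -> shrink e s = 0.
Proof. by move=> se; rewrite /shrink max_r// subrr expr0n mul0r. Qed.

Lemma shrink1_eq0 s : s <= e -> shrink1 e s = 0.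
Proof. by move=> se; rewrite /shrink1 max_r//; field; rewrite gt_eqF. Qed.

Lemma shrink_le s : 0 <= s -> shrink e s <= s.
Proof.
move=> s0; have [se|es] := leP s e; first by rewrite shrink_eq0.
have s1 : 0 < s by exact: lt_trans es.
rewrite /shrink (max_l (ltW es)) exprVn ler_pdivrMr ?exprn_gt0// -exprS.
by rewrite lerXn2r ?nnegrE ?subr_ge0 ?(ltW es)// lerBlDr lerDl ltW.
Qed.

(** The loss [3 * e] does not depend on [s], so over a domain of finite measure it disappears from
    the integral as [e] tends to [0]. *)
Lemma le_shrink s : s <= shrink e s + 3 * e.
Proof.
have [se|es] := leP s e; first rewrite shrink_eq0// add0r (le_trans se)//.
  by rewrite ler_peMl ?(ltW e0)// ler1n.
have s0 : 0 < s by exact: lt_trans es.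
rewrite /shrink (max_l (ltW es)).
have -> : (s - e) ^+ 3 * s^-1 ^+ 2 = s - 3 * e + e ^+ 2 * (3 * s - e) / s ^+ 2.
  by field; rewrite gt_eqF.
suff : 0 <= e ^+ 2 * (3 * s - e) / s ^+ 2 by lra.
rewrite mulr_ge0 ?invr_ge0 ?exprn_ge0 ?(ltW s0)// mulr_ge0 ?exprn_ge0 ?(ltW e0)//.
by rewrite subr_ge0 (le_trans (ltW es))// ler_peMl ?(ltW s0)// ler1n.
Qed.

End smooth_shrink.

(** * The mass of the heat kernel *)

Section smooth.
Context {R : realType} {n : nat}.
Variable U : set 'rV[R]_n.
Hypothesis oU : open U.
Implicit Types f g : 'rV[R]_n -> R.

(** The opposite of [laplacian], so that the heat equation equates the time derivative with
    [trace_hessian]. *)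
Definition trace_hessian f := fun x => \sum_(i < n) pderiv i (pderiv i f) x.

Lemma smooth_pderiv i f : smooth_on U f -> smooth_on U (pderiv i f).
Proof.
move=> sf s x Ux; rewrite /pderivs -[pderiv i f]/(foldr (@pderiv R n) f [:: i]).
by rewrite -foldr_cat; exact: sf.
Qed.

Lemma smooth_continuous f : smooth_on U f -> continuous_on U f.
Proof. by move=> sf y Uy; have [] := sf [::] y Uy. Qed.

Lemma smooth_derivable i f x : smooth_on U f -> U x ->
  derivable f x (delta_mx ord0 i).
Proof. by move=> sf Ux; have [_] := sf [::] x Ux. Qed.

Lemma near_on (P : 'rV[R]_n -> Prop) x : U x -> (forall y, U y -> P y) ->
  \forall y \near x, P y.
Proof.
move=> Ux UP; have : \forall y \near x, U y by exact: open_nbhs_nbhs.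
by apply: filterS.
Qed.

Lemma derivable_sum_pt m (h : 'I_m -> 'rV[R]_n -> R) x v :
  (forall j, derivable (h j) x v) ->
  derivable (fun y => \sum_(j < m) h j y) x v /\
  'D_v (fun y => \sum_(j < m) h j y) x = \sum_(j < m) 'D_v (h j) x.
Proof.
move=> dh; have -> : (fun y => \sum_(j < m) h j y) = \sum_(j < m) h j.
  by apply/funext => y; rewrite fct_sumE.
by split; [exact: derivable_sum|exact: derive_sum].
Qed.

(** Iterated partial derivatives commute with the sum only on [U]; since [U] is open, the identity
    holds near each of its points, which suffices to transfer continuity and derivability. *)
Lemma smooth_sum m (h : 'I_m -> 'rV[R]_n -> R) :
  (forall j, smooth_on U (h j)) -> smooth_on U (fun y => \sum_(j < m) h j y).
Proof.
move=> sh.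
have E s x : U x -> pderivs s (fun y => \sum_(j < m) h j y) x =
    \sum_(j < m) pderivs s (h j) x.
  elim: s x => [//|i s IH] x Ux /=; rewrite {1}/pderiv.
  rewrite (near_eq_derive (g := fun y => \sum_(j < m) pderivs s (h j) y)).
    by rewrite (derivable_sum_pt _).2// => j; have [] := sh j s x Ux.
  exact: near_on Ux IH.
move=> s x Ux.
have E' : \forall y \near x, \sum_(j < m) pderivs s (h j) y =
    pderivs s (fun y => \sum_(j < m) h j y) y.
  by apply: near_on Ux _ => y Uy; rewrite E.
split => [|i].
  apply: near_eq_continuous E' _.
  elim: (index_enum _) => [|j r IH].
    have -> : (fun y => \sum_(j <- [::]) pderivs s (h j) y) = cst 0.
      by apply/funext => y; rewrite big_nil.
    exact: cst_continuous.
  have -> : (fun y => \sum_(j <- j :: r) pderivs s (h j) y) =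
      (fun y => pderivs s (h j) y + \sum_(j <- r) pderivs s (h j) y).
    by apply/funext => y; rewrite big_cons.
  by apply: (@cvgD _ _ _ (nbhs x)) => //; have [] := sh j s x Ux.
apply: near_eq_derivable E' _.
by apply: (derivable_sum_pt _).1 => j; have [_] := sh j s x Ux.
Qed.

Lemma smooth_trace_hessian f : smooth_on U f -> smooth_on U (trace_hessian f).
Proof. by move=> sf; apply: smooth_sum => j; do 2 apply: smooth_pderiv. Qed.

Lemma smooth_iter_trace_hessian k f : smooth_on U f ->
  smooth_on U (iter k trace_hessian f).
Proof. by move=> hf; elim: k => // k IH; exact: smooth_trace_hessian. Qed.

Lemma flat_trace_hessian f : flat U f -> flat U (trace_hessian f).
Proof.
move=> ff z Bz.
have h i : \forall y \near z, U y -> pderiv i (pderiv i f) y = 0.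
  by apply: flat_pderiv => //; exact: flat_pderiv.
have : \forall y \near z, forall i, U y -> pderiv i (pderiv i f) y = 0.
  exact: (@filter_forall _ _ (fun i y => U y -> pderiv i (pderiv i f) y = 0) _ _ h).
apply: filterS => y hy Uy.
by rewrite /trace_hessian big1// => i _; exact: hy.
Qed.

Lemma flat_iter_trace_hessian k f : flat U f -> flat U (iter k trace_hessian f).
Proof. by move=> hf; elim: k => // k IH; exact: flat_trace_hessian. Qed.

End smooth.

(** * Decay in time of the truncated mass of the kernel *)

Section heat_kernel.
Context {R : realType} {n : nat}.
Variable Omega : set 'rV[R]_n.
Hypotheses (oO : open Omega) (bO : bounded_set Omega).
Variable K : 'rV[R]_n -> 'rV[R]_n -> R -> R.
Hypothesis hK : dirichlet_heat_kernel Omega K.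
Let mO := measurable_domain oO.

Lemma continuous_slice (T1 T2 U : topologicalType) (g : T1 -> T2 -> U) y t :
  {for (y, t), continuous (fun p => g p.1 p.2)} -> {for y, continuous (g ^~ t)}.
Proof.
move=> cg.
apply: (@continuous_comp _ _ _ (fun y => (y, t)) (fun p => g p.1 p.2)) => //.
by apply: cvg_pair; [exact: cvg_id|exact: cvg_cst].
Qed.

Variable x : 'rV[R]_n.
Hypothesis Ox : Omega x.

Lemma heat_kernel_dtE (y : 'rV[R]_n) (t : R) : Omega y -> 0 < t ->
  derive1 (K x y) t = trace_hessian (K x ^~ t) y.
Proof.
move=> Oy t0; have := heat_kernel_eq hK Ox Oy t0.
by rewrite /laplacian addrC => /eqP; rewrite subr_eq0 => /eqP.
Qed.

Lemma heat_kernel_flat (z : 'rV[R]_n) (t e : R) :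
  boundary Omega z -> 0 < t -> 0 < e ->
  \forall y \near z & s \near t, Omega y -> `|K x y s| < e.
Proof.
move=> Bz t0 e0; have /cvgr0Pnorm_lt/(_ e e0) := heat_kernel_boundary hK Ox Bz t0.
rewrite near_withinE; apply: filterS => -[y s] /= h Oy; exact: h.
Qed.

Lemma heat_kernel_bounded (t : R) : 0 < t ->
  exists M, forall y, Omega y -> `|K x y t| <= M.
Proof.
move=> t0.
have [||M hM] := @param_bounded _ _ _ bO R t (K x) 1.
- by move=> y Oy; have [_ ?] := heat_kernel_C21 hK Ox Oy t0.
- move=> z Bz; apply: filterS (heat_kernel_flat Bz t0 ltr01) => p h Oy.
  exact/ltW/h.
- by exists M; exact: nbhs_singleton hM.
Qed.

Lemma heat_kernel_continuous_on (t : R) : 0 < t -> continuous_on Omega (K x ^~ t).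
Proof.
move=> t0 y Oy; have [_ h _ _ _] := heat_kernel_C21 hK Ox Oy t0.
exact: continuous_slice h.
Qed.

Lemma heat_kernel_integrable (t : R) : 0 < t ->
  (lebesgue_rV R n).-integrable Omega (EFin \o (K x ^~ t)).
Proof.
move=> t0; have [M KM] := heat_kernel_bounded t0.
by apply: integrable_on KM => //; exact: heat_kernel_continuous_on.
Qed.

Lemma heat_kernel_is_derive_dt (y : 'rV[R]_n) (t : R) : Omega y -> 0 < t ->
  is_derive t (1 : R) (K x y) (derive1 (K x y) t).
Proof.
move=> Oy t0; have [[_ _ d] _ _ _ _] := heat_kernel_C21 hK Ox Oy t0.
by rewrite derive1E; exact: derivableP.
Qed.

Lemma heat_kernel_is_derive i (y : 'rV[R]_n) (t : R) : Omega y -> 0 < t ->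
  is_derive y (delta_mx ord0 i) (K x ^~ t) (pderiv i (K x ^~ t) y).
Proof.
move=> Oy t0; have [[d _ _] _ _ _ _] := heat_kernel_C21 hK Ox Oy t0.
exact: derivableP.
Qed.

Lemma heat_kernel_is_derive2 i (y : 'rV[R]_n) (t : R) : Omega y -> 0 < t ->
  is_derive y (delta_mx ord0 i) (pderiv i (K x ^~ t))
    (pderiv i (pderiv i (K x ^~ t)) y).
Proof.
move=> Oy t0; have [[_ d _] _ _ _ _] := heat_kernel_C21 hK Ox Oy t0.
exact: derivableP.
Qed.

Lemma heat_kernel_continuous_pderiv i (t : R) : 0 < t ->
  continuous_on Omega (pderiv i (K x ^~ t)).
Proof.
move=> t0 y Oy; have [_ _ h _ _] := heat_kernel_C21 hK Ox Oy t0.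
exact: (@continuous_slice _ _ _ (fun y t => pderiv i (K x ^~ t) y)).
Qed.

Lemma heat_kernel_continuous_pderiv2 i (t : R) : 0 < t ->
  continuous_on Omega (pderiv i (pderiv i (K x ^~ t))).
Proof.
move=> t0 y Oy; have [_ _ _ h _] := heat_kernel_C21 hK Ox Oy t0.
exact: (@continuous_slice _ _ _ (fun y t => pderiv i (pderiv i (K x ^~ t)) y)).
Qed.

Lemma nbhs_gt0 (t : R) : 0 < t -> \forall s \near t, 0 < s.
Proof. by move=> t0; exact: lt_nbhsr. Qed.

(** The Dirichlet condition makes the kernel small near the boundary, not zero; the truncation kills
    all values up to [e] and so turns smallness into flatness. *)
Lemma shrink_flat (e t : R) : 0 < e -> 0 < t ->
  near_flat Omega t (fun y s => shrink e (K x y s)) /\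
  near_flat Omega t (fun y s => shrink1 e (K x y s) * derive1 (K x y) s).
Proof.
move=> e0 t0; split => z Bz;
  apply: filterS (heat_kernel_flat Bz t0 e0) => -[y s] /= h Oy;
  have := ltr_normlW (h Oy) => /ltW Ke.
  by rewrite shrink_eq0.
by rewrite shrink1_eq0// mul0r.
Qed.

(** The field [F] is the gradient of [shrink e (k y)]. Its divergence integrates to zero and exceeds
    the integrand by [shrink2 e (k y)] times the squared gradient of [k], which is non-negative. *)
Lemma shrink_mass_derive_le0 (e t : R) : 0 < e -> 0 < t ->
  \int[lebesgue_rV R n]_(y in Omega) (shrink1 e (K x y t) * derive1 (K x y) t) <= 0.
Proof.
move=> e0 t0; pose k := K x ^~ t.
pose F i y := shrink1 e (k y) * pderiv i k y.
pose G i y := shrink2 e (k y) * pderiv i k y ^+ 2 +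
  shrink1 e (k y) * pderiv i (pderiv i k) y.
have DF i y : Omega y -> is_derive y (delta_mx ord0 i) (F i) (G i y).
  move=> Oy; have D1 := heat_kernel_is_derive i Oy t0.
  have D2 := heat_kernel_is_derive2 i Oy t0.
  have D3 := is_derive_scalar_comp (shrink1_is_derive e0 (k y)) D1.
  apply: is_derive_eq (@is_deriveM _ _ _ _ _ _ _ _ D3 D2) _.
  by rewrite /G /GRing.scale/= addrC -/k; ring.
have FG i y : Omega y -> pderiv i (F i) y = G i y.
  by move=> /(DF i)[].
have ck := heat_kernel_continuous_on t0.
have ck1 i := @heat_kernel_continuous_pderiv i t t0.
have ck2 i := @heat_kernel_continuous_pderiv2 i t t0.
have ct1 : continuous_on Omega (fun y => shrink1 e (k y)).
  by move=> y Oy; apply: continuous_comp; [exact: ck|exact: shrink1_continuous].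
have ct2 : continuous_on Omega (fun y => shrink2 e (k y)).
  by move=> y Oy; apply: continuous_comp; [exact: ck|exact: shrink2_continuous].
have cG i : continuous_on Omega (G i).
  move=> y Oy; apply: (@cvgD _ _ _ (nbhs y)); apply: (@cvgM _ _ (nbhs y)).
  - exact: ct2.
  - apply: (@cvgM _ _ (nbhs y)); exact: ck1.
  - exact: ct1.
  - exact: ck2.
have [] := @flat_integral_sum_pderiv _ _ _ oO bO F.
- move=> i y Oy; apply: near_eq_continuous (cG i y Oy).
  by apply: near_on Oy _ => // y' Oy'; rewrite FG.
- by move=> i y /(DF i)[].
- move=> i z Bz.
  have : \forall y \near z, Omega y -> `|k y| < e.
    have [[A C] /= [hA hC] AC] := heat_kernel_flat Bz t0 e0.
    apply: filterS hA => y Ay; apply: (AC (y, t)); split => //=.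
    exact: nbhs_singleton.
  apply: filterS => y h Oy.
  by rewrite /F shrink1_eq0// ?mul0r//; apply: ltW; exact: ltr_normlW (h Oy).
(* The zero on the right is replaced by the integral of the divergence of [F], so that the
   inequality can be checked pointwise. *)
move=> iF <-.
have cdt : continuous_on Omega (fun y => shrink1 e (K x y t) * derive1 (K x y) t).
  move=> y Oy; apply: (@cvgM _ _ (nbhs y)); first exact: ct1.
  have [_ _ _ _ h] := heat_kernel_C21 hK Ox Oy t0.
  exact: (@continuous_slice _ _ _ (fun y t => derive1 (K x y) t)).
have fdt : flat Omega (fun y => shrink1 e (K x y t) * derive1 (K x y) t).
  exact: near_flat_slice (shrink_flat e0 t0).2.
apply: le_Rintegral => //; first exact: flat_integrable.
move=> y Oy; rewrite heat_kernel_dtE// /trace_hessian mulr_sumr.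
apply: ler_sum => i _; rewrite FG// /G lerDr.
by rewrite mulr_ge0// ?sqr_ge0// shrink2_ge0.
Qed.

Lemma shrink_mass_is_derive (e t : R) : 0 < e -> 0 < t ->
  is_derive t (1 : R)
    (fun t => \int[lebesgue_rV R n]_(y in Omega) shrink e (K x y t))
    (\int[lebesgue_rV R n]_(y in Omega) (shrink1 e (K x y t) * derive1 (K x y) t)).
Proof.
move=> e0 t0.
have [f1 f2] := shrink_flat e0 t0.
apply: (@param_integral_is_derive _ _ _ oO bO t (fun y s => shrink e (K x y s))
  (fun y s => shrink1 e (K x y s) * derive1 (K x y) s)) => //.
- move=> y Oy; have [_ h _ _ _] := heat_kernel_C21 hK Ox Oy t0.
  apply: (@continuous_comp _ _ _ (fun p => K x p.1 p.2) (shrink e)) => //.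
  exact: shrink_continuous.
- move=> y Oy; have [_ h _ _ h'] := heat_kernel_C21 hK Ox Oy t0.
  apply: (@cvgM _ _ (nbhs (y, t))) => //.
  apply: (@continuous_comp _ _ _ (fun p => K x p.1 p.2) (shrink1 e)) => //.
  exact: shrink1_continuous.
- apply: filterS (nbhs_gt0 t0) => s s0 y Oy.
  apply: (@continuous_comp _ _ _ (K x ^~ s) (shrink e)).
    exact: heat_kernel_continuous_on.
  exact: shrink_continuous.
- apply: filterS (nbhs_gt0 t0) => s s0 y Oy.
  apply: (@is_derive_scalar_comp _ _ (shrink e) (K x y)).
    exact: shrink_is_derive.
  exact: heat_kernel_is_derive_dt.
Qed.

Lemma shrink_mass_nincr (e s t : R) : 0 < e -> 0 < s -> s <= t ->
  \int[lebesgue_rV R n]_(y in Omega) shrink e (K x y t) <=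
  \int[lebesgue_rV R n]_(y in Omega) shrink e (K x y s).
Proof.
move=> e0 s0 st; pose m t := \int[lebesgue_rV R n]_(y in Omega) shrink e (K x y t).
have D (r : R) : 0 < r -> is_derive r (1 : R) m _ :=
  fun r0 => shrink_mass_is_derive e0 r0.
have P (r : R) : r \in `]s, t[%R -> 0 < r.
  by rewrite in_itv/= => /andP[sr _]; exact: lt_trans sr.
apply: (@ler0_derive1_le_cc _ m s t) => //.
- by move=> r /P/D[].
- move=> r /P r0; rewrite derive1E; have [_ ->] := D r r0.
  exact: shrink_mass_derive_le0.
- apply: derivable_within_continuous => r; rewrite in_itv/= => /andP[sr _].
  by have [] := D r (lt_le_trans s0 sr).
- by rewrite in_itv/= st lexx.
- by rewrite in_itv/= st lexx.
Qed.

Lemma shrink_integrable (e t : R) : 0 < e -> 0 < t ->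
  (lebesgue_rV R n).-integrable Omega (EFin \o (fun y => shrink e (K x y t))).
Proof.
move=> e0 t0; apply: flat_integrable => // [y Oy|].
  apply: (@continuous_comp _ _ _ (K x ^~ t) (shrink e)).
    exact: heat_kernel_continuous_on.
  exact: shrink_continuous.
exact: near_flat_slice (shrink_flat e0 t0).1.
Qed.

Lemma heat_kernel_mass (t : R) :
  0 < t -> \int[lebesgue_rV R n]_(y in Omega) K x y t <= 1.
Proof.
move=> t0; set V := fine (lebesgue_rV R n Omega).
have V0 : 0 <= V by exact: fine_ge0.
(* The initial condition tested against the constant function [1]. *)
have c1 : (\int[lebesgue_rV R n]_(y in Omega) K x y s) @[s --> 0^'+] --> (1 : R).
  have H : (\int[lebesgue_rV R n]_(y in Omega) (K x y s * 1)) @[s --> 0^'+] -->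
      (1 : R).
    apply: (@heat_kernel_dirac _ _ _ _ hK (fun=> 1) x Ox).
      by move=> y _; exact: cst_continuous.
    by exists 1 => y _; rewrite normr1.
  move: H; under eq_fun do under eq_Rintegral do rewrite mulr1.
  exact.
(* For fixed [e], the truncated mass at [t] is at most the one at an earlier [s], hence at most the
   full mass at [s], which tends to [1]. *)
have T (e : R) : 0 < e -> \int[lebesgue_rV R n]_(y in Omega) shrink e (K x y t) <= 1.
  move=> e0; apply: cvgr_to_ge c1 _.
  have : \forall s \near 0^'+, 0 < s /\ s < t.
    by near=> s; split.
  apply: filterS => s [s0 st].
  apply: le_trans (shrink_mass_nincr e0 s0 (ltW st)) _.
  apply: le_Rintegral => //.
  - exact: shrink_integrable.
  - exact: heat_kernel_integrable.
  - by move=> y Oy; apply: shrink_le => //; exact: (heat_kernel_ge0 hK).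
apply/ler_addgt0Pr => d d0.
(* Chosen so that the total loss [3 * e * V] is at most [d]; [V + 1] avoids a division by zero. *)
pose e := d / (3 * (V + 1)).
have e0 : 0 < e by rewrite divr_gt0// mulr_gt0// ltr_wpDl.
have Ie : (lebesgue_rV R n).-integrable Omega (EFin \o (fun=> 3 * e)).
  by apply: (@integrable_on _ _ _ oO bO _ `|3 * e|) => // y _; exact: cst_continuous.
have It := shrink_integrable e0 t0.
have : \int[lebesgue_rV R n]_(y in Omega) K x y t <=
    \int[lebesgue_rV R n]_(y in Omega) (shrink e (K x y t) + 3 * e).
  apply: le_Rintegral => //; first exact: heat_kernel_integrable.
    by have := integrableD mO It Ie; apply: eq_integrable.
  by move=> y _; exact: le_shrink.
move=> /le_trans; apply; rewrite RintegralD// Rintegral_cst// lerD ?T//.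
have -> : 3 * e * V = d * V / (V + 1).
  by rewrite /e; field; rewrite gt_eqF// ltr_wpDl.
by rewrite ler_pdivrMr ?ltr_wpDl// ler_pM2l//; lra.
Unshelve. all: by end_near. Qed.

End heat_kernel.

(** * The heat flow of a test function *)

Lemma cvg_to_pair (T : Type) (F : set_system T) (U V : topologicalType)
    (f : T -> U) (g : T -> V) (a : U) (b : V) : Filter F ->
  f @ F --> a -> g @ F --> b -> (fun x => (f x, g x)) @ F --> (a, b).
Proof. by move=> FF fa gb; exact: (cvg_pair fa gb). Qed.

Section heat_flow.
Context {R : realType} {n : nat}.
Variable Omega : set 'rV[R]_n.
Hypotheses (oO : open Omega) (bO : bounded_set Omega).
Variable K : 'rV[R]_n -> 'rV[R]_n -> R -> R.
Hypothesis hK : dirichlet_heat_kernel Omega K.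
Let mO := measurable_domain oO.

(** This is [P_t phi x] in the outline above. *)
Definition heat_flow (phi : 'rV[R]_n -> R) x (t : R) :=
  \int[lebesgue_rV R n]_(y in Omega) (K x y t * phi y).

Variable phi : 'rV[R]_n -> R.
Hypotheses (sphi : smooth_on Omega phi) (fphi : flat Omega phi).

Lemma flat_near_flat (T : topologicalType) (s0 : T) (f : 'rV[R]_n -> R)
    (g : 'rV[R]_n -> T -> R) : flat Omega f ->
  (forall y s, f y = 0 -> g y s = 0) -> near_flat Omega s0 g.
Proof.
move=> ff fg z /ff h; exists ([set y | Omega y -> f y = 0], setT) => /=.
  by split => //; exact: filterT.
by move=> [y s] /= [fy _] Oy; apply: fg; exact: fy.
Qed.

(** Green's second identity for [phi] and [k], after the heat equation has turned the time
    derivative into [trace_hessian k]. The field [F] is flat because [phi] and its partial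
    derivatives are. *)
Lemma heat_kernel_green x (t : R) : Omega x -> 0 < t ->
  \int[lebesgue_rV R n]_(y in Omega) (derive1 (K x y) t * phi y) =
  heat_flow (trace_hessian phi) x t.
Proof.
move=> Ox t0; pose k := K x ^~ t.
pose F i y := phi y * pderiv i k y - k y * pderiv i phi y.
pose G i y := phi y * pderiv i (pderiv i k) y - k y * pderiv i (pderiv i phi) y.
have sphi1 i := smooth_pderiv i sphi.
have sphi2 i := smooth_pderiv i (sphi1 i).
have DF i y : Omega y -> is_derive y (delta_mx ord0 i) (F i) (G i y).
  move=> Oy; have D1 := heat_kernel_is_derive hK Ox i Oy t0.
  have D2 := heat_kernel_is_derive2 hK Ox i Oy t0.
  have P1 : is_derive y (delta_mx ord0 i) phi (pderiv i phi y) :=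
    derivableP (smooth_derivable (i := i) sphi Oy).
  have P2 : is_derive y (delta_mx ord0 i) (pderiv i phi)
      (pderiv i (pderiv i phi) y) :=
    derivableP (smooth_derivable (i := i) (sphi1 i) Oy).
  apply: is_derive_eq (@is_deriveB _ _ _ _ _ _ _ _ _
    (@is_deriveM _ _ _ _ _ _ _ _ P1 D2) (@is_deriveM _ _ _ _ _ _ _ _ D1 P2)) _.
  rewrite /G /GRing.scale/= -/k -[K x y t]/(k y).
  move: (pderiv i (pderiv i k) y) (pderiv i (pderiv i phi) y) (pderiv i k y)
    (pderiv i phi y) (k y) (phi y) => a b c d e f; ring.
have FG i y : Omega y -> pderiv i (F i) y = G i y by move=> /(DF i)[].
have ck := heat_kernel_continuous_on hK Ox t0.
have ck1 i : continuous_on Omega (pderiv i k).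
  by apply: heat_kernel_continuous_pderiv.
have ck2 i : continuous_on Omega (pderiv i (pderiv i k)).
  by apply: heat_kernel_continuous_pderiv2.
have cp := smooth_continuous sphi.
have cp2 i := smooth_continuous (sphi2 i).
have cG i : continuous_on Omega (G i).
  move=> y Oy; apply: (@cvgB _ _ _ (nbhs y)); apply: (@cvgM _ _ (nbhs y)).
  - exact: cp.
  - exact: ck2.
  - exact: ck.
  - exact: cp2.
have fp1 i := @flat_pderiv _ _ _ oO i _ fphi.
have [] := @flat_integral_sum_pderiv _ _ _ oO bO F.
- move=> i y Oy; apply: near_eq_continuous (cG i y Oy).
  by apply: near_on Oy _ => // y' Oy'; rewrite FG.
- by move=> i y /(DF i)[].
- move=> i z Bz; apply: filterS2 (fphi Bz) (fp1 i z Bz) => y h h1 Oy.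
  by rewrite /F h// h1// mul0r mulr0 subr0.
move=> _ I0.
have cd : continuous_on Omega (fun y => derive1 (K x y) t * phi y).
  move=> y Oy; apply: (@cvgM _ _ (nbhs y)); last exact: cp.
  have [_ _ _ _ h] := heat_kernel_C21 hK Ox Oy t0.
  exact: (@continuous_slice _ _ _ (fun y t => derive1 (K x y) t)).
have ch : continuous_on Omega (fun y => K x y t * trace_hessian phi y).
  move=> y Oy; apply: (@cvgM _ _ (nbhs y)); first exact: ck.
  exact: (smooth_continuous (smooth_trace_hessian oO sphi)).
have fd : flat Omega (fun y => derive1 (K x y) t * phi y).
  by move=> z /fphi; apply: filterS => y h Oy; rewrite h// mulr0.
have fh : flat Omega (fun y => K x y t * trace_hessian phi y).
  move=> z /(flat_trace_hessian oO fphi).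
  by apply: filterS => y h Oy; rewrite h// mulr0.
apply/eqP; rewrite -subr_eq0 /heat_flow -RintegralB//;
  [|exact: flat_integrable|exact: flat_integrable].
rewrite -[X in _ == X]I0; apply/eqP; apply: eq_Rintegral => y /set_mem Oy.
rewrite (heat_kernel_dtE hK)// /trace_hessian mulr_suml mulr_sumr -sumrB.
by apply: eq_bigr => i _; rewrite FG// /G -/k [X in X - _]mulrC.
Qed.

Lemma heat_flow_is_derive x (t : R) : Omega x -> 0 < t ->
  is_derive t (1 : R) (heat_flow phi x) (heat_flow (trace_hessian phi) x t).
Proof.
move=> Ox t0; rewrite -heat_kernel_green//.
have cp := smooth_continuous sphi.
have cphi y : Omega y -> {for (y, t), continuous (fun p : 'rV[R]_n * R => phi p.1)}.
  move=> Oy; apply: (@continuous_comp _ _ _ fst phi); first exact: cvg_fst.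
  exact: cp.
apply: (@param_integral_is_derive _ _ _ oO bO t (fun y s => K x y s * phi y)
  (fun y s => derive1 (K x y) s * phi y)).
- move=> y Oy; have [_ h _ _ _] := heat_kernel_C21 hK Ox Oy t0.
  apply: (@cvgM _ _ (nbhs (y, t))) => //; exact: cphi.
- move=> y Oy; have [_ _ _ _ h] := heat_kernel_C21 hK Ox Oy t0.
  apply: (@cvgM _ _ (nbhs (y, t))) => //; exact: cphi.
- by apply: flat_near_flat fphi _ => y s ->; rewrite mulr0.
- by apply: flat_near_flat fphi _ => y s ->; rewrite mulr0.
- apply: filterS (nbhs_gt0 t0) => s s0 y Oy.
  apply: (@cvgM _ _ (nbhs y)); last exact: cp.
  exact: (heat_kernel_continuous_on hK Ox s0).
- apply: filterS (nbhs_gt0 t0) => s s0 y Oy.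
  have D := heat_kernel_is_derive_dt hK Ox Oy s0.
  apply: is_derive_eq (@is_deriveM _ _ _ _ _ _ _ _ D (is_derive_cst (phi y) s 1)) _.
  by rewrite /GRing.scale/= mulr0 add0r mulrC.
Qed.

(** The kernel is non-negative with total mass at most [1], so integrating against it does not
    increase a uniform bound. *)
Lemma heat_flow_bound x (t M : R) : Omega x -> 0 < t ->
  (forall y, Omega y -> `|phi y| <= M) -> `|heat_flow phi x t| <= M.
Proof.
move=> Ox t0 pM; have M0 : 0 <= M by apply: le_trans (pM x Ox).
have cp := smooth_continuous sphi.
have I1 : (lebesgue_rV R n).-integrable Omega (EFin \o (fun y => K x y t * phi y)).
  apply: flat_integrable => // [y Oy|z /fphi].
    apply: (@cvgM _ _ (nbhs y)); last exact: cp.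
    exact: (heat_kernel_continuous_on hK Ox t0).
  by apply: filterS => y h Oy; rewrite h// mulr0.
have IK := heat_kernel_integrable oO bO hK Ox t0.
apply: le_trans (le_normr_Rintegral mO I1) _.
apply: (@le_trans _ _ (\int[lebesgue_rV R n]_(y in Omega) (M * K x y t))).
  apply: le_Rintegral => //.
  - exact: integrable_norm.
  - by have := integrableZl mO M IK; apply: eq_integrable.
  - move=> y Oy; have K0 := heat_kernel_ge0 hK Ox Oy t0.
    by rewrite normrM ger0_norm// mulrC ler_wpM2r// pM.
by rewrite RintegralZl// ler_piMr//; exact: (heat_kernel_mass oO bO hK).
Qed.

(** The pair [(x, t)] serves as the parameter, using joint continuity of the kernel in all three
    variables. Continuity in [x] is what the outer integral of [heat_pairing] needs. *)
Lemma heat_flow_continuous x (t : R) : Omega x -> 0 < t ->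
  {for (x, t), continuous (fun p => heat_flow phi p.1 p.2)}.
Proof.
move=> Ox t0; have cp := smooth_continuous sphi.
have cm (y : 'rV[R]_n) : {for (y, (x, t)),
    continuous (fun p : 'rV[R]_n * ('rV[R]_n * R) => ((p.2.1, p.1), p.2.2))}.
  have c2 : (fun p : 'rV[R]_n * ('rV[R]_n * R) => p.2) @ (y, (x, t)) --> (x, t).
    exact: cvg_snd.
  apply: (@cvg_to_pair _ (nbhs (y, (x, t)))); last first.
    exact: (@cvg_comp _ _ _ _ snd _ _ _ c2 cvg_snd).
  apply: (@cvg_to_pair _ (nbhs (y, (x, t)))); last exact: cvg_fst.
  exact: (@cvg_comp _ _ _ _ fst _ _ _ c2 cvg_fst).
apply: (@param_integral_cvg _ _ _ oO bO _ (x, t) (fun y s => K s.1 y s.2 * phi y)).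
- move=> y Oy; apply: (@cvgM _ _ (nbhs (y, (x, t)))).
    apply: (@continuous_comp _ _ _ _ (fun p => K p.1.1 p.1.2 p.2) _ (cm y)).
    exact: (heat_kernel_continuous hK Ox Oy t0).
  apply: (@continuous_comp _ _ _ fst phi); first exact: cvg_fst.
  exact: cp.
- by apply: flat_near_flat fphi _ => y s ->; rewrite mulr0.
- exists (Omega, [set s | 0 < s]) => /=.
    by split; [exact: open_nbhs_nbhs|exact: nbhs_gt0].
  move=> [x' s] /= [Ox' s0] y Oy; apply: (@cvgM _ _ (nbhs y)); last exact: cp.
  exact: (heat_kernel_continuous_on hK Ox' s0).
Qed.

Lemma heat_flow_cvg0 x : Omega x -> heat_flow phi x t @[t --> 0^'+] --> phi x.
Proof.
move=> Ox; have cp := smooth_continuous sphi.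
by apply: (heat_kernel_dirac hK Ox) => //; exact: flat_bounded.
Qed.

End heat_flow.

(** * Voronoi cells and cut-off functions *)

(** Induction on the order: [f] and [h 0] agree only for positive times, but the half-line is open,
    so derivatives there depend on nothing else. *)
Lemma derive1n_family (R : realType) (h : nat -> R -> R) (f : R -> R) :
  (forall k (t : R), 0 < t -> is_derive t (1 : R) (h k) (h k.+1 t)) ->
  (forall t : R, 0 < t -> f t = h 0 t) ->
  forall k (t : R), 0 < t -> derive1n k f t = h k t /\ derivable (derive1n k f) t 1.
Proof.
move=> dh fh0.
have E k : (forall t : R, 0 < t -> derive1n k f t = h k t) ->
    forall t : R, 0 < t -> is_derive t (1 : R) (derive1n k f) (h k.+1 t).
  move=> fk t t0; apply: near_eq_is_derive (dh k t t0).
  by apply: filterS (nbhs_gt0 t0) => s s0; rewrite fk.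
have H k : forall t : R, 0 < t -> derive1n k f t = h k t.
  elim: k => [t t0|k IH t t0]; first by rewrite derive1n0 fh0.
  by rewrite derive1nS derive1E; have [_ ->] := E k IH t t0.
by move=> k t t0; split; [exact: H|have [] := E k (H k) t t0].
Qed.

(** * The heat flow integrated against a second test function *)

Section heat_pairing.
Context {R : realType} {n : nat}.
Variable Omega : set 'rV[R]_n.
Hypotheses (oO : open Omega) (bO : bounded_set Omega).
Variable K : 'rV[R]_n -> 'rV[R]_n -> R -> R.
Hypothesis hK : dirichlet_heat_kernel Omega K.
Let mO := measurable_domain oO.

Definition heat_pairing (psi phi : 'rV[R]_n -> R) (t : R) :=
  \int[lebesgue_rV R n]_(x in Omega) (psi x * heat_flow Omega K phi x t).

Variables psi phi : 'rV[R]_n -> R.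
Hypotheses (cpsi : continuous_on Omega psi) (fpsi : flat Omega psi).
Hypotheses (sphi : smooth_on Omega phi) (fphi : flat Omega phi).

Lemma heat_pairing_integrand_continuous (f : 'rV[R]_n -> R) (t : R) :
  smooth_on Omega f -> flat Omega f -> 0 < t ->
  forall x, Omega x -> {for (x, t), continuous
    (fun p : 'rV[R]_n * R => psi p.1 * heat_flow Omega K f p.1 p.2)}.
Proof.
move=> sf ff t0 x Ox; apply: (@cvgM _ _ (nbhs (x, t))).
  apply: (@continuous_comp _ _ _ fst psi); first exact: cvg_fst.
  exact: cpsi.
exact: (heat_flow_continuous oO bO hK sf ff Ox t0).
Qed.

Lemma heat_pairing_integrand_continuous_on (t : R) : 0 < t ->
  continuous_on Omega (fun x => psi x * heat_flow Omega K phi x t).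
Proof.
move=> t0 x Ox.
exact: (@continuous_slice _ _ _ (fun x t => psi x * heat_flow Omega K phi x t) _ _
  (heat_pairing_integrand_continuous sphi fphi t0 Ox)).
Qed.

(** A second differentiation under the integral, now in [x]; flatness of the integrand comes from
    [psi], whatever the heat flow does near the boundary. *)
Lemma heat_pairing_is_derive (t : R) : 0 < t ->
  is_derive t (1 : R) (heat_pairing psi phi)
    (heat_pairing psi (trace_hessian phi) t).
Proof.
move=> t0.
have sphi' := smooth_trace_hessian oO sphi.
have fphi' := flat_trace_hessian oO fphi.
apply: (@param_integral_is_derive _ _ _ oO bO t
  (fun x s => psi x * heat_flow Omega K phi x s)
  (fun x s => psi x * heat_flow Omega K (trace_hessian phi) x s)).
- exact: (heat_pairing_integrand_continuous sphi fphi t0).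
- exact: (heat_pairing_integrand_continuous sphi' fphi' t0).
- by apply: flat_near_flat fpsi _ => y s ->; rewrite mul0r.
- by apply: flat_near_flat fpsi _ => y s ->; rewrite mul0r.
- apply: filterS (nbhs_gt0 t0) => s s0.
  exact: heat_pairing_integrand_continuous_on.
- apply: filterS (nbhs_gt0 t0) => s s0 x Ox.
  have D := heat_flow_is_derive oO bO hK sphi fphi Ox s0.
  apply: is_derive_eq (@is_deriveM _ _ _ _ _ _ _ _ (is_derive_cst (psi x) s 1) D) _.
  by rewrite /GRing.scale/= mulr0 addr0.
Qed.

Lemma heat_pairing_bound : exists C, forall t : R, 0 < t ->
  `|heat_pairing psi phi t| <= C.
Proof.
have [A psiA] := flat_bounded bO cpsi fpsi.
have [M phiM] := flat_bounded bO (smooth_continuous sphi) fphi.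
(* [A] and [M] bound [psi] and [phi]; the heat flow inherits the bound [M] at every positive time,
   whence a constant independent of [t]. *)
exists (A * M * fine (lebesgue_rV R n Omega)) => t t0.
apply: (Rintegral_bound oO bO).
  exact: heat_pairing_integrand_continuous_on.
move=> x Ox; rewrite normrM ler_pM//; first exact: psiA.
exact: (heat_flow_bound oO bO hK sphi fphi Ox t0 phiM).
Qed.

Lemma heat_pairing_cvg0 : heat_pairing psi phi t @[t --> 0^'+] -->
  \int[lebesgue_rV R n]_(x in Omega) (psi x * phi x).
Proof.
have [A psiA] := flat_bounded bO cpsi fpsi.
have [M phiM] := flat_bounded bO (smooth_continuous sphi) fphi.
have cpp : continuous_on Omega (fun x => psi x * phi x).
  move=> x Ox; apply: (@cvgM _ _ (nbhs x)); first exact: cpsi.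
  exact: (smooth_continuous sphi).
(* The limit is tested along sequences of positive times, to which dominated convergence applies
   with the constant [|A| * |M|]. *)
apply/cvg_at_rightP => u [u0 ucvg].
have [|||||_ _ H] := @dominated_convergence _ _ _ (lebesgue_rV R n) Omega mO
  (fun k x => (psi x * heat_flow Omega K phi x (u k))%:E)
  (fun x => (psi x * phi x)%:E) (fun=> (`|A| * `|M|)%:E).
- move=> k; apply/measurable_EFinP; apply: open_continuous_measurable_rV => //.
  exact: heat_pairing_integrand_continuous_on.
- by apply/measurable_EFinP; exact: open_continuous_measurable_rV.
- apply/aeW => x Ox; apply: cvg_EFin; first exact: nearW.
  apply: cvgM; first exact: cvg_cst.
  have /cvg_at_rightP := heat_flow_cvg0 bO hK sphi fphi Ox.
  by apply; split.
- apply: (@integrable_on _ _ _ oO bO (fun=> `|A| * `|M|) (`|A| * `|M|)) => y Oy.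
    exact: cst_continuous.
  by rewrite ger0_norm// mulr_ge0.
- apply/aeW => x k Ox; rewrite lee_fin normrM ler_pM//.
    by apply: le_trans (psiA _ Ox) _; exact: ler_norm.
  apply: le_trans (heat_flow_bound oO bO hK sphi fphi Ox (u0 k) phiM) _.
  exact: ler_norm.
have fpp : flat Omega (fun x => psi x * phi x).
  by move=> z /fphi; apply: filterS => y h Oy; rewrite h// mulr0.
have fin := integrable_fin_num mO (flat_integrable oO bO cpp fpp).
by rewrite /heat_pairing /Rintegral; apply: fine_cvg; rewrite fineK.
Qed.

End heat_pairing.

(** * Geometry of the cells, and the reduction of [H0] to a heat pairing *)

Section voronoi_cells.
Context {R : realType} {n : nat}.

Lemma continuous_eucl_dist (v x : 'rV[R]_n) :
  {for x, continuous (fun y => eucl_dist y v)}.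
Proof.
apply: (@continuous_comp _ _ _
  (fun y : 'rV[R]_n => \sum_(i < n) (y ord0 i - v ord0 i) ^+ 2) Num.sqrt);
  last exact: sqrt_continuous.
elim: (index_enum _) => [|j r IH].
  have -> : (fun y : 'rV[R]_n => \sum_(i <- [::]) (y ord0 i - v ord0 i) ^+ 2) =
      cst 0.
    by apply/funext => y; rewrite big_nil.
  exact: cst_continuous.
have -> : (fun y : 'rV[R]_n => \sum_(i <- j :: r) (y ord0 i - v ord0 i) ^+ 2) =
    (fun y => (y ord0 j - v ord0 j) ^+ 2 + \sum_(i <- r) (y ord0 i - v ord0 i) ^+ 2).
  by apply/funext => y; rewrite big_cons.
apply: (@cvgD _ _ _ (nbhs x)) => //.
apply: (@continuous_comp _ _ _ (fun y : 'rV[R]_n => y ord0 j - v ord0 j)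
  (fun a => a ^+ 2)); last exact: exprn_continuous.
by apply: (@cvgB _ _ _ (nbhs x)); [exact: coord_continuous_rV|exact: cvg_cst].
Qed.

Lemma eucl_distxx (x : 'rV[R]_n) : eucl_dist x x = 0.
Proof.
by rewrite /eucl_dist big1 ?sqrtr0// => i _; rewrite subrr expr0n.
Qed.

Lemma eucl_dist_gt0 (x y : 'rV[R]_n) : x != y -> 0 < eucl_dist x y.
Proof.
move=> xy; rewrite sqrtr_gt0 lt_neqAle sumr_ge0 ?andbT; last first.
  by move=> i _; exact: sqr_ge0.
apply: contra xy => /eqP/esym/eqP; rewrite psumr_eq0; last first.
  by move=> i _; exact: sqr_ge0.
move=> /allP h; apply/eqP/rowP => i; have := h i (mem_index_enum i).
by rewrite sqrf_eq0 subr_eq0 => /eqP.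
Qed.

Lemma near_all_seq (T : eqType) (X : Type) (F : set_system X) (s : seq T)
    (P : T -> X -> Prop) : Filter F ->
  (forall v, v \in s -> \forall x \near F, P v x) ->
  \forall x \near F, forall v, v \in s -> P v x.
Proof.
move=> FF; elim: s => [_|a s IH Ps]; first exact: nearW.
have h1 : \forall x \near F, P a x by apply: Ps; rewrite mem_head.
have h2 : \forall x \near F, forall v, v \in s -> P v x.
  by apply: IH => v vs; apply: Ps; rewrite inE vs orbT.
apply: filterS2 h1 h2 => x Pa Ps' v; rewrite inE => /predU1P[->//|]; exact: Ps'.
Qed.

Variables (Omega : set 'rV[R]_n) (G : graph 'rV[R]_n).
Hypotheses (oO : open Omega) (bO : bounded_set Omega).
Hypothesis hG : forall v, v \in vertices G -> Omega v.

Lemma voronoi_sub v : voronoi Omega G v `<=` Omega.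
Proof. by move=> x []. Qed.

(** The cell is cut out of an open set by finitely many strict inequalities between continuous
    distances. *)
Lemma open_voronoi v : open (voronoi Omega G v).
Proof.
rewrite openE => x [Ox hx].
have h1 : \forall y \near x, Omega y by exact: open_nbhs_nbhs.
have h2 : \forall y \near x, forall v', v' \in (vertices G : seq _) ->
    v' != v -> eucl_dist y v < eucl_dist y v'.
  apply: (@near_all_seq _ _ (nbhs x) (vertices G)
    (fun v' y => v' != v -> eucl_dist y v < eucl_dist y v')) => v' v'G.
  have [->|v'v] := eqVneq v' v; first exact: nearW.
  have : \forall y \near x, 0 < eucl_dist y v' - eucl_dist y v.
    have C : (eucl_dist y v' - eucl_dist y v) @[y --> x] -->
        eucl_dist x v' - eucl_dist x v.
      by apply: (@cvgB _ _ _ (nbhs x)); exact: continuous_eucl_dist.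
    by apply: (cvgr_gt _ C); rewrite subr_gt0; exact: hx.
  by apply: filterS => y; rewrite subr_gt0.
by apply: filterS2 h1 h2 => y Oy hy; split.
Qed.

Lemma voronoi_center v : v \in vertices G -> voronoi Omega G v v.
Proof.
move=> vG; split => [|v' v'G v'v]; first exact: hG.
by rewrite eucl_distxx eucl_dist_gt0// eq_sym.
Qed.

Lemma voronoi_disjoint v1 v2 x : v1 \in vertices G -> v2 \in vertices G ->
  v1 != v2 -> voronoi Omega G v1 x -> ~ voronoi Omega G v2 x.
Proof.
move=> v1G v2G v12 [_ h1] [_ h2].
have v21 : v2 != v1 by rewrite eq_sym.
by have := lt_trans (h1 v2 v2G v21) (h2 v1 v1G v12); rewrite ltxx.
Qed.

Lemma voronoi_mass_fin v : (lebesgue_rV R n (voronoi Omega G v) < +oo)%E.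
Proof.
apply: lebesgue_rV_bounded; first by apply: open_measurable_rV; exact: open_voronoi.
have [M [Mr OM]] := bO; exists M; split => // k Mk x Vx.
exact: (OM k Mk x (voronoi_sub Vx)).
Qed.

(** The cell is open and contains [v], so it has positive measure; the normalising factor of [H0] is
    then a true inverse. *)
Lemma cell_mass_gt0 v : v \in vertices G -> 0 < cell_mass Omega G v.
Proof.
move=> vG; apply: fine_gt0; rewrite voronoi_mass_fin andbT.
apply: (@lebesgue_rV_open_gt0 _ _ _ v); first exact: open_voronoi.
exact: voronoi_center.
Qed.

Variables (delta : R) (eta : 'rV[R]_n -> 'rV[R]_n -> R).
Hypotheses (delta0 : 0 < delta) (heta : cutoff_family Omega G delta eta).

Lemma set_dist_le (x z : 'rV[R]_n) (A : set 'rV[R]_n) :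
  A z -> set_dist x A <= eucl_dist x z.
Proof.
move=> Az; apply: ge_inf; last by exists z.
by exists 0 => _ [y _ <-]; exact: sqrtr_ge0.
Qed.

(* A point of the frontier of the cell is at distance 0 from it, so its
   neighbours in the cell lie in the collar of width [delta / 2]. *)
Lemma cutoff_near_out v z : v \in vertices G -> ~ voronoi Omega G v z ->
  \forall y \near z, Omega y -> eta v y = 0.
Proof.
move=> vG nVz; have [cz|ncz] := pselect (closure (voronoi Omega G v) z).
  have Bz : boundary (voronoi Omega G v) z by split => // /interior_subset.
  have : \forall y \near z, eucl_dist y z < delta / 2.
    apply: (cvgr_lt _ (@continuous_eucl_dist z z)).
    by rewrite eucl_distxx divr_gt0.
  apply: filterS => y yz Oy.
  have [Vy|nVy] := pselect (voronoi Omega G v y); last exact: (cutoff_out heta).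
  apply: (cutoff_collar heta) => //; split => //.
  exact: le_lt_trans (set_dist_le _ Bz) yz.
have : \forall y \near z, (~` closure (voronoi Omega G v)) y.
  apply: open_nbhs_nbhs; split => //.
  by apply: closed_openC; exact: closed_closure.
apply: filterS => y ny Oy; apply: (cutoff_out heta) => // Vy.
by apply: ny; exact: subset_closure.
Qed.

(** A boundary point of the open set [Omega] is not in [Omega], hence in no cell. This makes the
    cut-off functions admissible test functions. *)
Lemma cutoff_flat v : v \in vertices G -> flat Omega (eta v).
Proof.
move=> vG z Bz; apply: cutoff_near_out => // /voronoi_sub.
exact: boundaryNdomain Bz.
Qed.

Lemma Rintegral_support (A : set 'rV[R]_n) (f : 'rV[R]_n -> R) : A `<=` Omega ->
  (forall x, Omega x -> ~ A x -> f x = 0) ->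
  \int[lebesgue_rV R n]_(x in A) f x = \int[lebesgue_rV R n]_(x in Omega) f x.
Proof.
move=> AO f0; rewrite Rintegral_mkcond [RHS]Rintegral_mkcond; congr Rintegral.
apply/funext => x; rewrite !patchE; have [xA|xA] := boolP (x \in A).
  by rewrite mem_set//; apply: AO; exact: set_mem.
have [xO|//] := boolP (x \in Omega).
by rewrite f0//; [exact: set_mem|move=> Ax; move/negP: xA; apply; exact: mem_set].
Qed.

Variable K : 'rV[R]_n -> 'rV[R]_n -> R -> R.
Hypothesis hK : dirichlet_heat_kernel Omega K.

(** Each cut-off function vanishes outside its cell, so both integrals extend to [Omega]; then
    [eta v1 x] leaves the inner one. *)
Lemma H0_heat_pairing v1 v2 (t : R) : v1 \in vertices G -> v2 \in vertices G ->
  0 < t ->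
  H0 Omega G K eta v1 v2 t =
  (Num.sqrt (cell_mass Omega G v1 * cell_mass Omega G v2))^-1 *
  heat_pairing Omega K (eta v1) (eta v2) t.
Proof.
move=> v1G v2G t0; congr (_ * _).
have s2 := cutoff_smooth heta v2G; have c2 := smooth_continuous s2.
have f2 := cutoff_flat v2G.
rewrite /heat_pairing -(@Rintegral_support (voronoi Omega G v1)); first last.
- by move=> x Ox nVx; rewrite (cutoff_out heta)// mul0r.
- exact: voronoi_sub.
apply: eq_Rintegral => x /set_mem/voronoi_sub Ox.
rewrite (@Rintegral_support (voronoi Omega G v2)); first last.
- by move=> y Oy nVy; rewrite (cutoff_out heta v2G)// mulr0.
- exact: voronoi_sub.
under eq_Rintegral do rewrite -mulrA mulrCA.
rewrite RintegralZl//; first exact: measurable_domain.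
apply: flat_integrable => // [y Oy|z /f2].
  apply: (@cvgM _ _ (nbhs y)); last exact: c2.
  exact: (heat_kernel_continuous_on hK Ox t0).
by apply: filterS => y h Oy; rewrite h// mulr0.
Qed.

End voronoi_cells.

(** * The limit at time zero and the derivative bounds *)

Theorem proposition7 (R : realType) (n : nat)
    (Omega : set 'rV[R]_n.+1) (hOmega : bounded_smooth_domain Omega)
    (G : graph 'rV[R]_n.+1)
    (hG : forall v, v \in vertices G -> Omega v)
    (hcell : forall v, v \in vertices G -> path_connected R (voronoi Omega G v))
    (K : 'rV[R]_n.+1 -> 'rV[R]_n.+1 -> R -> R)
    (hK : dirichlet_heat_kernel Omega K)
    (eps delta : R) (heps : 0 < eps) (hdelta : 0 < delta)
    (hwidth : admissible_width Omega G eps delta)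
    (eta : 'rV[R]_n.+1 -> 'rV[R]_n.+1 -> R)
    (heta : cutoff_family Omega G delta eta) :
  (forall v1 v2, v1 \in vertices G -> v2 \in vertices G ->
     H0 Omega G K eta v1 v2 t @[t --> 0^'+] --> (if v1 == v2 then 1 else 0 : R))
  /\
  (forall (k : nat) v1 v2, v1 \in vertices G -> v2 \in vertices G ->
     exists C : R, forall t : R, 0 < t ->
       (forall j : nat, (j < k)%N ->
          derivable (derive1n j (H0 Omega G K eta v1 v2)) t 1) /\
       `| (derive1n k (H0 Omega G K eta v1 v2)) t | <= C).
Proof.
have [oO _ _ bO _] := hOmega.
have fe v (vG : v \in vertices G) := cutoff_flat oO hdelta heta vG.
have se v (vG : v \in vertices G) := cutoff_smooth heta vG.
have ce v (vG : v \in vertices G) := smooth_continuous (se v vG).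
pose c v1 v2 := (Num.sqrt (cell_mass Omega G v1 * cell_mass Omega G v2))^-1.
split => [v1 v2 v1G v2G|k v1 v2 v1G v2G].
- have E : \forall t \near 0^'+, c v1 v2 * heat_pairing Omega K (eta v1) (eta v2) t =
      H0 Omega G K eta v1 v2 t.
    near=> t; rewrite (H0_heat_pairing oO bO hdelta heta hK v1G v2G)//.
  apply: cvg_trans (near_eq_cvg E) _.
  (* On the diagonal the normalisation of [eta v1] makes the integral equal to the cell mass, which
     the factor cancels; off it, disjointness of the cells makes the product vanish. *)
  have -> : (if v1 == v2 then 1 else 0) = c v1 v2 *
      \int[lebesgue_rV R n.+1]_(x in Omega) (eta v1 x * eta v2 x) :> R.
    have [<-|v12] := eqVneq v1 v2.
      have m0 := cell_mass_gt0 oO bO hG v1G.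
      under eq_Rintegral do rewrite -expr2.
      rewrite (cutoff_mass heta)// /c -expr2 sqrtr_sqr gtr0_norm// mulVf//.
      by rewrite gt_eqF.
    rewrite (@eq_Rintegral _ _ _ _ _ (fun=> 0)) ?Rintegral_cst ?mul0r ?mulr0//.
      exact: measurable_domain.
    move=> x /set_mem Ox; have [Vx|nVx] := pselect (voronoi Omega G v1 x).
      by rewrite (cutoff_out heta v2G Ox) ?mulr0//; exact: voronoi_disjoint Vx.
    by rewrite (cutoff_out heta v1G Ox) ?mul0r.
  apply: cvgM; first exact: cvg_cst.
  exact: (heat_pairing_cvg0 oO bO hK (ce _ v1G) (fe _ v1G) (se _ v2G) (fe _ v2G)).
(* Each time derivative moves one more Laplacian onto [eta v2], so [h j] below is the [j]-th
   derivative of [H0] at positive times. *)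
pose phi j := iter j trace_hessian (eta v2).
have sphi j : smooth_on Omega (phi j).
  exact: smooth_iter_trace_hessian (se _ v2G).
have fphi j : flat Omega (phi j).
  exact: flat_iter_trace_hessian (fe _ v2G).
pose h j t := c v1 v2 * heat_pairing Omega K (eta v1) (phi j) t.
have dh j (t : R) : 0 < t -> is_derive t (1 : R) (h j) (h j.+1 t).
  move=> t0; have D := heat_pairing_is_derive oO bO hK (ce _ v1G) (fe _ v1G)
    (sphi j) (fphi j) t0.
  exact: is_deriveZ.
have D := derive1n_family dh
  (fun t t0 => H0_heat_pairing oO bO hdelta heta hK v1G v2G t0).
have [C hC] := heat_pairing_bound oO bO hK (ce _ v1G) (fe _ v1G) (sphi k) (fphi k).
(* [D] gives both the value of each iterated derivative and its derivability; [C] comes from the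
   pairing with [phi k]. *)
exists (`|c v1 v2| * C) => t t0; split => [j _|]; first by have [] := D j t t0.
by have [-> _] := D k t t0; rewrite /h normrM ler_wpM2l// hC.
Unshelve. all: by end_near. Qed.
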